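(* Let $R$ be a left GF-closed ring, let $M$ be a left $R$-module, and let $n\ge 0$ be an integer. The following are equivalent: (1) $\mathrm{Gfd}_R(M)\le n$; (2) $\mathrm{Gfd}_R(M)<\infty$ and $\mathrm{Tor}^R_i(I,M)=0$ for all $i>n$ and all injective right $R$-modules $I$; (3) $\mathrm{Gfd}_R(M)<\infty$ and $\mathrm{Tor}^R_i(E,M)=0$ for all $i>n$ and all right $R$-modules $E$ with $\mathrm{id}_R(E)<\infty$; (4) for every exact sequence of left $R$-modules $0\to K_n\to G_{n-1}\to\cdots\to G_0\to M\to 0$, if each $G_i$ ($0\le i\le n-1$) is Gorenstein flat, then so is $K_n$. Furthermore, if $\mathrm{Gfd}_R(M)<\infty$, then $$\mathrm{Gfd}_R(M)=\sup\{i\in\mathbb{N}\mid \mathrm{Tor}^R_i(E,M)\neq 0\text{ for some right }R\text{-module }E\text{ with }\mathrm{id}_R(E)<\infty\}$$ $$=\sup\{i\in\mathbb{N}\mid \mathrm{Tor}^R_i(I,M)\neq 0\text{ for some injective right }R\text{-module }I\}.$$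
   Context: All rings are associative with identity and all modules are unitary. $\mathrm{id}_R(E)$ denotes the injective dimension of $E$. A left $R$-module $M$ is Gorenstein flat if there exists an exact sequence of flat left $R$-modules $\cdots\to F_1\to F_0\to F^0\to F^1\to\cdots$ such that $M\cong \mathrm{Im}(F_0\to F^0)$ and such that $I\otimes_R -$ leaves the sequence exact whenever $I$ is an injective right $R$-module. For an integer $n\ge 0$, $\mathrm{Gfd}_R(M)\le n$ means that there is an exact sequence of left $R$-modules $0\to G_n\to\cdots\to G_0\to M\to 0$ with each $G_i$ Gorenstein flat; $\mathrm{Gfd}_R(M)$ (the Gorenstein flat dimension) is the least such $n$, and $\infty$ if there is none. A ring $R$ is left GF-closed if the class of Gorenstein flat left $R$-modules is closed under extensions: for every short exact sequence of left $R$-modules $0\to A\to B\to C\to 0$ with $A$ and $C$ Gorenstein flat, $B$ is Gorenstein flat. Here $\mathbb{N}$ includes $0$ and suprema are taken in $\mathbb{N}\cup\{\infty\}$ (so $\sup\emptyset=0$). For $n=0$ the sequence in (4) reads $0\to K_0\to M\to 0$. *)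

(* Defs.v *)
From HB Require Import structures.
From mathcomp Require Import all_boot all_algebra ring_quotient.
From mathcomp Require Import mathcomp_extra boolp classical_sets functions.
From mathcomp Require Import cardinality fsbigop.

Set Implicit Arguments.
Unset Strict Implicit.
Unset Printing Implicit Defensive.

Import GRing.Theory.
Local Open Scope ring_scope.

(* Left R-modules are [lmodType R]; right R-modules are left modules over the
   converse ring, [lmodType R^c], the right action x . r being (r : R^c) *: x.
   [pzRingType] is the type of associative rings with identity (the zero ring
   is allowed), and [lmodType] includes 1 *: x = x.  Most definitions below are
   stated for the underlying functions; the homomorphism structure is carried
   by the bundled types {additive _ -> _} and {linear _ -> _}. *)

Definition exact (A B C : zmodType) (f : A -> B) (g : B -> C) : Prop :=
  forall b : B, g b = 0 <-> exists a : A, f a = b.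

Definition surjective (A B : Type) (f : A -> B) : Prop :=
  forall b : B, exists a : A, f a = b.

Definition short_exact (A B C : zmodType) (f : A -> B) (g : B -> C) : Prop :=
  [/\ injective f, exact f g & surjective g].

Definition trivial_module (A : zmodType) : Prop := forall a : A, a = 0.

Section Kernel.
Variables (U V : zmodType) (f : {additive U -> V}).

Definition ker_pred : pred U := fun x => f x == 0.

Lemma ker_pred_zmod_closed : zmod_closed ker_pred.
Proof.
split=> [|x y]; rewrite !unfold_in /ker_pred ?raddf0 //.
by move=> /eqP fx /eqP fy; rewrite raddfB fx fy subr0.
Qed.

HB.instance Definition _ :=
  GRing.isZmodClosed.Build U ker_pred ker_pred_zmod_closed.

Definition ker : Type := {x : U | ker_pred x}.

HB.instance Definition _ := SubType.on ker.
HB.instance Definition _ := [Choice of ker by <:].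
HB.instance Definition _ := [SubChoice_isSubZmodule of ker by <:].

End Kernel.

Section LinearKernel.
Variables (R : pzRingType) (U V : lmodType R) (f : {linear U -> V}).

Definition lker_pred : pred U := fun x => f x == 0.

Lemma lker_pred_submod_closed : subsemimod_closed lker_pred.
Proof.
split=> [|a x]; last first.
  by rewrite !unfold_in /lker_pred linearZ_LR => /eqP ->; rewrite scaler0.
split=> [|x y]; rewrite !unfold_in /lker_pred ?linear0 //.
by move=> /eqP fx /eqP fy; rewrite linearD fx fy addr0.
Qed.

HB.instance Definition _ :=
  GRing.isSubmodClosed.Build R U lker_pred lker_pred_submod_closed.

Definition lker : Type := {x : U | lker_pred x}.

HB.instance Definition _ := SubType.on lker.
HB.instance Definition _ := [Choice of lker by <:].
HB.instance Definition _ := [SubChoice_isSubLmodule of lker by <:].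

End LinearKernel.

Section LinearImage.
Variables (R : pzRingType) (U V : lmodType R) (f : {linear U -> V}).

Definition limage_pred : pred V := fun y => `[< exists x, f x = y >].

Lemma limage_pred_submod_closed : subsemimod_closed limage_pred.
Proof.
split=> [|a _ /asboolP[x <-]]; last first.
  by apply/asboolP; exists (a *: x); rewrite linearZ_LR.
split=> [|_ _ /asboolP[x <-] /asboolP[y <-]]; apply/asboolP.
  by exists 0; rewrite linear0.
by exists (x + y); rewrite linearD.
Qed.

HB.instance Definition _ :=
  GRing.isSubmodClosed.Build R V limage_pred limage_pred_submod_closed.

Definition limage : Type := {y : V | limage_pred y}.

HB.instance Definition _ := SubType.on limage.
HB.instance Definition _ := [Choice of limage by <:].
HB.instance Definition _ := [SubChoice_isSubLmodule of limage by <:].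

End LinearImage.

Definition isomorphic (R : pzRingType) (M N : lmodType R) : Prop :=
  exists f : {linear M -> N}, bijective f.

(* R^(X) as the finitely supported functions X -> R. *)
Section Free.
Variables (R : pzRingType) (X : choiceType).

Definition free_pred : pred (X -> R^o) :=
  fun u => `[< finite_set [set x | u x != 0] >].

Lemma free_pred_submod_closed : subsemimod_closed free_pred.
Proof.
split=> [|a u /asboolP fu]; last first.
  apply/asboolP; apply: sub_finite_set fu => x /=.
  by apply: contra_neq => ux0; rewrite -[(a *: u) x]/(a *: (u x)) ux0 scaler0.
split=> [|u v /asboolP fu /asboolP fv]; apply/asboolP.
  by apply: (sub_finite_set _ (finite_set0 X)) => x /=; rewrite eqxx.
have fuv : finite_set ([set x | u x != 0] `|` [set x | v x != 0])%classic.
  by rewrite finite_setU.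
apply: sub_finite_set fuv => x /= uvx.
case: (eqVneq (u x) 0) => [ux0|]; last by left.
right; apply: contra_neq uvx => vx0.
by rewrite -[(u + v) x]/(u x + v x) ux0 vx0 addr0.
Qed.

HB.instance Definition _ :=
  GRing.isSubmodClosed.Build R (X -> R^o) free_pred free_pred_submod_closed.

Definition free : Type := {u : X -> R^o | free_pred u}.

HB.instance Definition _ := SubType.on free.
HB.instance Definition _ := [Choice of free by <:].
HB.instance Definition _ := [SubChoice_isSubLmodule of free by <:].

Lemma free_basis_subproof (x : X) :
  free_pred (fun y => if y == x then 1 else 0).
Proof.
apply/asboolP; apply: (sub_finite_set _ (finite_set1 x)) => y /=.
by case: (eqVneq y x) => //; rewrite eqxx.
Qed.

Definition free_basis (x : X) : free := exist (fun u => free_pred u) _ (free_basis_subproof x).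

Lemma free_finite_support (u : free) : finite_set [set x | val u x != 0].
Proof. exact/asboolP/(valP u). Qed.

Definition free_lift (V : lmodType R) (g : X -> V) (u : free) : V :=
  \sum_(x \in [set: X]) (val u x : R) *: g x.

Lemma free_lift_seq (V : lmodType R) (g : X -> V) (u : free) (s : seq X) :
  uniq s -> (forall x, val u x != 0 -> x \in s) ->
  free_lift g u = \sum_(x <- s) (val u x : R) *: g x.
Proof.
move=> us hs; rewrite /free_lift (fsbigE s) //; last first.
  move=> x _; case: (eqVneq (val u x) 0) => [-> _|/hs ->] //; exact: scale0r.
by apply: eq_bigl => x; apply/asboolP.
Qed.

Lemma free_lift_is_linear (V : lmodType R) (g : X -> V) :
  linear (free_lift g).
Proof.
move=> a u v.
have fuv : finite_set
    ([set x | val u x != 0] `|` [set x | val v x != 0])%classic.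
  by rewrite finite_setU; split; exact: free_finite_support.
have [s us hs] : exists2 s : seq X, uniq s &
    forall x, (val u x != 0) || (val v x != 0) -> x \in s.
  have [s hs] := (finite_seqP _).1 fuv.
  exists (undup s); first exact: undup_uniq.
  move=> x xuv; rewrite mem_undup.
  suff: [set` s]%classic x by [].
  by rewrite -hs /=; case/orP: xuv; [left|right].
rewrite [free_lift g u](@free_lift_seq _ g u s us); last first.
  by move=> x ux; apply: hs; rewrite ux.
rewrite [free_lift g v](@free_lift_seq _ g v s us); last first.
  by move=> x vx; apply: hs; rewrite vx orbT.
rewrite (@free_lift_seq _ g _ s us); last first.
  move=> x auvx; apply: hs; apply: contraNT auvx.
  rewrite negb_or !negbK => /andP[/eqP ux0 /eqP vx0].
  by rewrite -[val _ x]/(a *: (val u x) + val v x) ux0 vx0 scaler0 addr0.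
rewrite scaler_sumr -big_split /=; apply: eq_bigr => x _.
by rewrite scalerA -scalerDl.
Qed.

HB.instance Definition _ (V : lmodType R) (g : X -> V) :=
  GRing.isLinear.Build R free V *:%R (free_lift g) (free_lift_is_linear g).

Lemma free_lift_basis (V : lmodType R) (g : X -> V) (x : X) :
  free_lift g (free_basis x) = g x.
Proof.
rewrite (@free_lift_seq _ g _ [:: x]) //; last first.
  by move=> y /=; rewrite inE; case: (y == x) => //; rewrite eqxx.
by rewrite big_seq1 /= eqxx scale1r.
Qed.

End Free.

Inductive zspan (V : zmodType) (S : V -> Prop) : V -> Prop :=
| zspan0 : zspan S 0
| zspan_gen x of S x : zspan S x
| zspan_sub x y of zspan S x & zspan S y : zspan S (x - y).

Section Span.
Variables (V : zmodType) (S : V -> Prop).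

Definition zspan_pred (x : V) : bool := `[< zspan S x >].

Lemma zspan_pred_zmod_closed : zmod_closed zspan_pred.
Proof.
split=> [|x y /asboolP Sx /asboolP Sy]; apply/asboolP; first exact: zspan0.
exact: zspan_sub.
Qed.

HB.instance Definition _ :=
  GRing.isZmodClosed.Build V zspan_pred zspan_pred_zmod_closed.

Definition zspan_closed : zmodClosed V :=
  GRing.ZmodClosed.clone V zspan_pred _.

End Span.

(* E (x)_R M as Z^(E x M) modulo the subgroup generated by the usual
   bilinearity and balancing relators. *)
Section Tensor.
Variables (R : pzRingType) (E : lmodType R^c) (M : lmodType R).

Local Notation "<< x , y >>" :=
  (free_basis int (x : E, y : M) : free int (E * M)%type).

Variant tensor_relator : free int (E * M)%type -> Prop :=
| relator_addl (x x' : E) (y : M) :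
    tensor_relator (<< x + x', y >> - << x, y >> - << x', y >>)
| relator_addr (x : E) (y y' : M) :
    tensor_relator (<< x, y + y' >> - << x, y >> - << x, y' >>)
| relator_bal (r : R) (x : E) (y : M) :
    tensor_relator (<< (r : R^c) *: x, y >> - << x, r *: y >>).

Definition tensor : zmodType := Quotient.quot (zspan_closed tensor_relator).

Definition to_tensor (u : free int (E * M)%type) : tensor :=
  (\pi_(Quotient.quot (zspan_closed tensor_relator)) u)%qT.

Definition pure_tensor (x : E) (y : M) : tensor := to_tensor << x, y >>.

Lemma to_tensorB (u v : free int (E * M)%type) :
  to_tensor (u - v) = to_tensor u - to_tensor v.
Proof. by rewrite /to_tensor raddfB. Qed.

Lemma to_tensor_eq (u v : free int (E * M)%type) :
  (to_tensor u = to_tensor v) <-> zspan tensor_relator (u - v).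
Proof.
split=> [/eqP|uv].
  by rewrite /to_tensor -Quotient.idealrBE => /asboolP.
by apply/eqP; rewrite /to_tensor -Quotient.idealrBE; apply/asboolP.
Qed.

End Tensor.

Section TensorMap.
Variables (R : pzRingType) (E E' : lmodType R^c) (M M' : lmodType R).
Variables (f : {linear E -> E'}) (g : {linear M -> M'}).

Definition free_tensor_map :
    free int (E * M)%type -> free int (E' * M')%type :=
  free_lift (fun p : E * M => free_basis int (f p.1, g p.2)).

(* The homomorphism f (x) g, characterised by [tensor_map_pure]. *)
Definition tensor_map (t : tensor E M) : tensor E' M' :=
  to_tensor (free_tensor_map (repr t)).

Lemma free_tensor_map_span (u : free int (E * M)%type) :
  zspan (@tensor_relator R E M) u ->
  zspan (@tensor_relator R E' M') (free_tensor_map u).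
Proof.
elim=> {u} [|u [x x' y|x y y'|r x y]|u v _ IHu _ IHv]; rewrite /free_tensor_map.
- by rewrite linear0; exact: zspan0.
- rewrite !linearB /= !free_lift_basis /= linearD.
  exact/zspan_gen/relator_addl.
- rewrite !linearB /= !free_lift_basis /= linearD.
  exact/zspan_gen/relator_addr.
- rewrite !linearB /= !free_lift_basis /= !linearZ_LR.
  exact/zspan_gen/relator_bal.
- by rewrite linearB; exact: zspan_sub.
Qed.

Lemma tensor_map_to_tensor (u : free int (E * M)%type) :
  tensor_map (to_tensor u) = to_tensor (free_tensor_map u).
Proof.
rewrite /tensor_map; apply/to_tensor_eq; rewrite -linearB.
by apply/free_tensor_map_span/to_tensor_eq; rewrite /to_tensor reprK.
Qed.

Lemma tensor_map_is_zmod_morphism : zmod_morphism tensor_map.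
Proof.
move=> s t.
have [u ->] : exists u, s = to_tensor u by exists (repr s); rewrite /to_tensor reprK.
have [v ->] : exists v, t = to_tensor v by exists (repr t); rewrite /to_tensor reprK.
by rewrite -to_tensorB !tensor_map_to_tensor -to_tensorB /free_tensor_map linearB.
Qed.

HB.instance Definition _ :=
  GRing.isZmodMorphism.Build (tensor E M) (tensor E' M') tensor_map
    tensor_map_is_zmod_morphism.

Lemma tensor_map_pure (x : E) (y : M) :
  tensor_map (pure_tensor x y) = pure_tensor (f x) (g y).
Proof.
by rewrite /pure_tensor tensor_map_to_tensor /free_tensor_map free_lift_basis.
Qed.

End TensorMap.

(* ker g / (im f inside ker g); this is the homology of A -> B -> C when
   g \o f = 0. *)
Section Homology.
Variables (A B C : zmodType) (f : {additive A -> B}) (g : {additive B -> C}).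

Definition boundary_pred (z : ker g) : bool := `[< exists a, f a = val z >].

Lemma boundary_pred_zmod_closed : zmod_closed boundary_pred.
Proof.
split=> [|x y /asboolP[a ax] /asboolP[b by_]]; apply/asboolP.
  by exists 0; rewrite !raddf0.
by exists (a - b); rewrite !raddfB ax by_.
Qed.

HB.instance Definition _ :=
  GRing.isZmodClosed.Build (ker g) boundary_pred boundary_pred_zmod_closed.

Definition homology : zmodType :=
  Quotient.quot (GRing.ZmodClosed.clone (ker g) boundary_pred _).

End Homology.

(* The canonical free resolution ... -> F_1 -> F_0 -> M: F_n is the free module
   on the underlying set of the n-th syzygy, syzygy 0 = M, and syzygy n.+1 is
   the kernel of the evaluation F_n -> syzygy n. *)
Section Tor.
Variable R : pzRingType.

Definition free_eval (M : lmodType R) : {linear free R M -> M} :=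
  free_lift (fun x : M => x).

Fixpoint syzygy (n : nat) (M : lmodType R) : lmodType R :=
  if n is k.+1 then lker (free_eval (syzygy k M)) else M.

Definition res_obj (M : lmodType R) (n : nat) : lmodType R :=
  free R (syzygy n M).

Definition res_incl (M : lmodType R) (n : nat) :
    {linear syzygy n.+1 M -> res_obj M n} :=
  (val : lker (free_eval (syzygy n M)) -> free R (syzygy n M)).

Definition res_diff (M : lmodType R) (n : nat) :
    {linear res_obj M n.+1 -> res_obj M n} :=
  res_incl M n \o free_eval (syzygy n.+1 M).

Definition tensor_res_diff (E : lmodType R^c) (M : lmodType R) (n : nat) :
    {additive tensor E (res_obj M n.+1) -> tensor E (res_obj M n)} :=
  tensor_map (idfun : {linear E -> E}) (res_diff M n).

(* The complex is E (x) F_*, with zero map out of degree 0. *)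
Definition Tor (i : nat) (E : lmodType R^c) (M : lmodType R) : zmodType :=
  if i is k.+1 then homology (tensor_res_diff E M k.+1) (tensor_res_diff E M k)
  else homology (tensor_res_diff E M 0)
         (\0 : {additive tensor E (res_obj M 0) -> tensor E (res_obj M 0)}).

Definition flat (F : lmodType R) : Prop :=
  forall (A B C : lmodType R^c) (f : {linear A -> B}) (g : {linear B -> C}),
    exact f g ->
    exact (tensor_map f (idfun : {linear F -> F}))
          (tensor_map g (idfun : {linear F -> F})).

End Tor.

Definition injective_module (S : pzRingType) (I : lmodType S) : Prop :=
  forall (A B : lmodType S) (f : {linear A -> B}) (g : {linear A -> I}),
    injective f -> exists h : {linear B -> I}, forall a, h (f a) = g a.

(* ... -> X 1 -> X 0 -> Y 0 -> Y 1 -> ... is exact. *)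
Definition exact_two_sided (X Y : nat -> zmodType)
    (d : forall n, X n.+1 -> X n) (m : X 0%N -> Y 0%N)
    (e : forall n, Y n -> Y n.+1) : Prop :=
  [/\ forall n, exact (d n.+1) (d n), exact (d 0%N) m, exact m (e 0%N)
    & forall n, exact (e n) (e n.+1)].

(* ... -> X 1 -> X 0 -> A -> 0 is exact. *)
Definition exact_left (X : nat -> zmodType) (A : zmodType)
    (d : forall n, X n.+1 -> X n) (e : X 0%N -> A) : Prop :=
  [/\ forall n, exact (d n.+1) (d n), exact (d 0%N) e & surjective e].

(* 0 -> A -> X 0 -> X 1 -> ... is exact. *)
Definition exact_right (A : zmodType) (X : nat -> zmodType)
    (e : A -> X 0%N) (d : forall n, X n -> X n.+1) : Prop :=
  [/\ injective e, exact e (d 0%N) & forall n, exact (d n) (d n.+1)].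

Section Gorenstein.
Variable R : pzRingType.

Definition gorenstein_flat (M : lmodType R) : Prop :=
  exists (X Y : nat -> lmodType R) (d : forall n, {linear X n.+1 -> X n})
         (m : {linear X 0%N -> Y 0%N}) (e : forall n, {linear Y n -> Y n.+1}),
    [/\ (forall n, flat (X n)) /\ (forall n, flat (Y n)),
        exact_two_sided (X := X) (Y := Y) d m e,
        isomorphic M (limage m)
      & forall I : lmodType R^c, injective_module I ->
          exact_two_sided
            (X := fun n => tensor I (X n)) (Y := fun n => tensor I (Y n))
            (fun n => tensor_map (idfun : {linear I -> I}) (d n))
            (tensor_map (idfun : {linear I -> I}) m)
            (fun n => tensor_map (idfun : {linear I -> I}) (e n))].

Definition GF_closed : Prop :=
  forall (A B C : lmodType R) (f : {linear A -> B}) (g : {linear B -> C}),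
    short_exact f g -> gorenstein_flat A -> gorenstein_flat C ->
    gorenstein_flat B.

(* 0 -> X n -> ... -> X 0 -> M -> 0 is exact: a finite sequence is an infinite
   one whose terms vanish beyond degree n; for n = 0 this is 0 -> X 0 -> M -> 0. *)
Definition left_resolution (n : nat) (M : lmodType R) (X : nat -> lmodType R)
    (d : forall i, {linear X i.+1 -> X i}) (e : {linear X 0%N -> M}) : Prop :=
  exact_left (X := X) d e /\ forall i, (n < i)%N -> trivial_module (X i).

Definition Gfd_le (M : lmodType R) (n : nat) : Prop :=
  exists (G : nat -> lmodType R) (d : forall i, {linear G i.+1 -> G i})
         (e : {linear G 0%N -> M}),
    left_resolution n d e /\ forall i, (i <= n)%N -> gorenstein_flat (G i).

End Gorenstein.

Definition id_le (S : pzRingType) (E : lmodType S) (n : nat) : Prop :=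
  exists (I : nat -> lmodType S) (e : {linear E -> I 0%N})
         (d : forall i, {linear I i -> I i.+1}),
    [/\ exact_right (X := I) e d,
        forall i, (n < i)%N -> trivial_module (I i)
      & forall i, (i <= n)%N -> injective_module (I i)].

(* [natbar] is N \cup {oo}. *)
Definition natbar : Type := option nat.
Definition infty : natbar := None.

Definition nat_least (P : nat -> Prop) : natbar :=
  if pselect (exists n, `[< P n >]) is left exP then Some (ex_minn exP)
  else infty.

(* The supremum in N \cup {oo}: the least upper bound in N if there is an upper
   bound in N, and oo otherwise; the supremum of the empty set is 0. *)
Definition nat_sup (A : nat -> Prop) : natbar :=
  nat_least (fun n => forall i, A i -> (i <= n)%N).

Definition Gfd (R : pzRingType) (M : lmodType R) : natbar :=
  nat_least (Gfd_le M).

Definition id_dim (S : pzRingType) (E : lmodType S) : natbar :=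
  nat_least (id_le E).

(* Main.v *)
From HB Require Import structures.
From mathcomp Require Import all_boot all_algebra ring_quotient.
From mathcomp Require Import boolp classical_sets functions cardinality.
Require Import Defs.

(** Write [Tor i E M = 0] for the triviality of that group.  Gorenstein flat
modules are acyclic for [Tor i I -] when [I] is injective and [i > 0], so
dimension shifting along a Gorenstein flat resolution shows that a module of
Gorenstein flat dimension at most [n] has [Tor i I M = 0] for [i > n]; a finite
injective resolution of [E] transports this to every [E] of finite injective
dimension ([Tor_id_le]).  The work lies in the two converse directions: reading
Gorenstein flatness of a syzygy off the dimension, and reading it off Tor.

Everything rests on one recognition principle, valid over any ring
([gorenstein_flat_of_coker]): in a short exact sequence [A -> F -> G] with [F]
flat and [G] Gorenstein flat, [A] is Gorenstein flat.  Indeed a free resolution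
of [A] may be spliced with the right half of a complete resolution of [G], and
the result stays exact after tensoring with an injective because [A] and [G] are
acyclic.  When Gorenstein flat modules are closed under extensions this gives:

- kernels of epimorphisms between Gorenstein flat modules are Gorenstein flat
  ([gorenstein_flat_kernel]).  For [A -> B -> C], pull [B -> C] back along a
  flat cover [F -> C]: the pullback [D] is an extension of [B] by the kernel of
  the cover, hence Gorenstein flat; it embeds in a flat [F'] with Gorenstein
  flat cokernel, and then [F' / A] is an extension of [F' / D] by [F].
- if [A -> B -> M] is exact with [A] and [B] Gorenstein flat and
  [Tor 1 I M = 0] for all injective [I], then [M] is Gorenstein flat
  ([gorenstein_flat_quotient]).  Push [A -> B] out along an embedding of [A] in
  a flat [F] and embed the pushout in a flat [F']: [M] embeds in [F' / F] with
  Gorenstein flat cokernel, and [F' / F] is flat because it has flat dimension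
  at most one, [Tor 1 I] of it vanishes for injective [I], and every right
  module embeds in an injective one ([flat_of_tor_injective]).

The first fact and closure under extensions show, by comparing two
presentations of [M] through their pullback, that every [n]-th syzygy of a
module of dimension at most [n] built from Gorenstein flat modules is Gorenstein
flat ([gf_resolved_syzygy]).  The second fact lowers the dimension one step at a
time as long as Tor vanishes ([gf_resolved_of_Tor]).  The formulas for the
dimension follow, since both suprema and the dimension are least elements of the
same set of integers.

Tor is handled without long exact sequences.  The vanishing of [Tor 1 E N] means
that [E] preserves the injectivity of the first map of every short exact
sequence ending in [N] ([tor1_zero]), and a chase in a three by three diagram
makes this symmetric in [E] and [N].  Higher Tor groups then become first Tor
groups of a syzygy of either argument ([Tor_trivial_syzygy], [Tor_trivial]), and
the parts of the long exact sequences that are needed become statements about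
composites of injective maps. *)

Set Implicit Arguments.
Unset Strict Implicit.
Unset Printing Implicit Defensive.

Import GRing.Theory.
Local Open Scope ring_scope.

(** * Linear maps and cokernels *)

Section LinearConstructions.
Variable R : pzRingType.
Implicit Types U V W : lmodType R.

Lemma linear_bundle U V (f : U -> V) :
  linear f -> exists g : {linear U -> V}, forall x, g x = f x.
Proof.
move=> lf; pose m := GRing.isLinear.Build R U V *:%R f lf.
pose g : {linear U -> V} := HB.pack f m.
by exists g.
Qed.

Lemma linear_factor_surj U V W (p : {linear U -> V}) (h : {linear U -> W}) :
  surjective p -> (forall x, p x = 0 -> h x = 0) ->
  exists k : {linear V -> W}, forall x, k (p x) = h x.
Proof.
move=> sp ph.
have [s sK] : exists s : V -> U, forall y, p (s y) = y.
  by exists (fun y => sval (cid (sp y))) => y; case: cid.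
have hE x y : p x = p y -> h x = h y.
  by move=> xy; apply/eqP; rewrite -subr_eq0 -linearB ph // linearB xy subrr.
have [|k kE] := @linear_bundle V W (fun y => h (s y)).
  by move=> a x y; rewrite -linearP; apply: hE; rewrite sK linearP !sK.
by exists k => x; rewrite kE; apply: hE; rewrite sK.
Qed.

Lemma linear_factor_inj U V W (i : {linear U -> V}) (h : {linear W -> V}) :
  injective i -> (forall x, exists y, i y = h x) ->
  exists k : {linear W -> U}, forall x, i (k x) = h x.
Proof.
move=> ii ih.
have [s sK] : exists s : W -> U, forall y, i (s y) = h y.
  by exists (fun y => sval (cid (ih y))) => y; case: cid.
have [|k kE] := @linear_bundle W U s.
  by move=> a x y; apply: ii; rewrite linearP !sK linearP.
by exists k => x; rewrite kE sK.
Qed.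

Section Cokernel.
Variables (U V : lmodType R) (f : {linear U -> V}).

Definition image_zmod : zmodClosed V := GRing.ZmodClosed.clone V (limage_pred f) _.

(** The abelian group quotient of [V] by the image of [f], made a module below
    by scaling representatives. *)
Definition coker : Type := Quotient.quot image_zmod.
HB.instance Definition _ := GRing.Zmodule.on coker.

Definition coker_pi (v : V) : coker := (\pi_(Quotient.quot image_zmod) v)%qT.

Lemma coker_piB : zmod_morphism coker_pi.
Proof. by move=> x y; rewrite /coker_pi raddfB. Qed.
HB.instance Definition _ := GRing.isZmodMorphism.Build V coker coker_pi coker_piB.

Lemma coker_piK (x : coker) : coker_pi (repr x) = x.
Proof. by rewrite /coker_pi reprK. Qed.

Lemma coker_pi_eq0 v : coker_pi v = 0 <-> exists u, f u = v.
Proof.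
rewrite -(raddf0 coker_pi); split=> [/eqP|fv].
  by rewrite -Quotient.idealrBE subr0 => /asboolP.
by apply/eqP; rewrite -Quotient.idealrBE subr0; apply/asboolP.
Qed.

Definition coker_scale (a : R) (x : coker) : coker := coker_pi (a *: repr x).

Lemma coker_pi_scale a v : coker_pi (a *: v) = coker_scale a (coker_pi v).
Proof.
apply/eqP; rewrite -subr_eq0 -raddfB -scalerBr; apply/eqP/coker_pi_eq0.
have [u fu] : exists u, f u = v - repr (coker_pi v).
  by apply/coker_pi_eq0; rewrite raddfB /= coker_piK subrr.
by exists (a *: u); rewrite linearZ_LR fu.
Qed.

Lemma coker_scaleA a b v : coker_scale a (coker_scale b v) = coker_scale (a * b) v.
Proof. by rewrite -[v]coker_piK -!coker_pi_scale scalerA. Qed.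
Lemma coker_scale1 : left_id 1 coker_scale.
Proof. by move=> v; rewrite -[v]coker_piK -!coker_pi_scale scale1r. Qed.
Lemma coker_scaleDr : right_distributive coker_scale +%R.
Proof.
move=> a u v; rewrite -[u]coker_piK -[v]coker_piK.
by rewrite -raddfD -!coker_pi_scale scalerDr raddfD.
Qed.
Lemma coker_scaleDl v : {morph coker_scale^~ v : a b / a + b}.
Proof.
by move=> a b /=; rewrite -[v]coker_piK -!coker_pi_scale scalerDl raddfD.
Qed.
HB.instance Definition _ := GRing.Zmodule_isLmodule.Build R coker
  coker_scaleA coker_scale1 coker_scaleDr coker_scaleDl.

Lemma coker_pi_scalable : scalable coker_pi.
Proof. exact: coker_pi_scale. Qed.
HB.instance Definition _ :=
  GRing.isScalable.Build R V coker *:%R coker_pi coker_pi_scalable.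

End Cokernel.
End LinearConstructions.

(** * Short exact sequences: pullbacks, pushouts and chains *)

Section ShortExactSequences.
Variable R : pzRingType.

Lemma lker_short_exact (U V : lmodType R) (f : {linear U -> V}) :
  surjective f -> short_exact (val : {linear lker f -> U}) f.
Proof.
move=> sf; split=> // x.
split=> [fx0|[y <-]]; last exact/eqP/(valP y).
have px : lker_pred f x by apply/eqP.
by exists (exist (fun z => lker_pred f z) x px).
Qed.

Lemma coker_short_exact (U V : lmodType R) (f : {linear U -> V}) :
  injective f -> short_exact f (coker_pi f).
Proof.
move=> inf; split=> // [x|x]; first exact: coker_pi_eq0.
by exists (repr x); rewrite coker_piK.
Qed.

Lemma limage_factor (U V : lmodType R) (f : {linear U -> V}) :
  exists (p : {linear U -> limage f}) (v : {linear limage f -> V}),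
    [/\ surjective p, injective v & forall x, v (p x) = f x].
Proof.
pose v : {linear limage f -> V} := val.
have iv : injective v by exact: val_inj.
have [|p pE] := @linear_factor_inj R _ _ _ v f iv.
  move=> x; have fx : limage_pred f (f x) by apply/asboolP; exists x.
  by exists (exist (fun y => limage_pred f y) _ fx).
exists p, v; split=> // y; have /asboolP[x xE] := valP y.
by exists x; apply: iv; rewrite pE.
Qed.

Lemma short_exact_comp0 (U V W : lmodType R) (f : {linear U -> V})
    (g : {linear V -> W}) : short_exact f g -> forall x, g (f x) = 0.
Proof. by move=> [_ fg _] x; apply/fg; exists x. Qed.

(** The pullback of two surjections onto [N] is an extension in two ways,
    each projection having the kernel of the opposite surjection. *)
Lemma pullback (K P N A B : lmodType R)
    (f : {linear K -> P}) (g : {linear P -> N})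
    (f' : {linear A -> B}) (g' : {linear B -> N}) :
  short_exact f g -> short_exact f' g' ->
  exists (D : lmodType R) (i : {linear K -> D}) (b : {linear D -> B})
         (j : {linear A -> D}) (a : {linear D -> P}),
    [/\ short_exact i b, short_exact j a,
        forall x, a (i x) = f x & forall x, b (j x) = f' x].
Proof.
move=> fg fg'; have [inf efg sg] := fg; have [inf' efg' sg'] := fg'.
have [|h hE] := @linear_bundle R (P * B)%type N (fun z => g z.1 - g' z.2).
  by move=> c x y /=; rewrite !linearP /= scalerDr addrACA.
have [|i iE] := @linear_bundle R K (P * B)%type (fun x => (f x, 0)).
  by move=> c x y /=; rewrite linearP; congr pair; rewrite /= scaler0 addr0.
have [|j jE] := @linear_bundle R A (P * B)%type (fun x => (0, f' x)).
  by move=> c x y /=; rewrite linearP; congr pair; rewrite /= scaler0 addr0.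
have [|a aE] := @linear_bundle R (P * B)%type P fst; first by [].
have [|b bE] := @linear_bundle R (P * B)%type B snd; first by [].
pose D := lker h; pose v : {linear D -> (P * B)%type} := val.
have vP z : h z = 0 -> exists y, v y = z.
  move=> /eqP hz; by exists (exist (fun z => lker_pred h z) z hz).
have vI : injective v by exact: val_inj.
have v0 y : g (v y).1 = g' (v y).2.
  by apply/eqP; rewrite -subr_eq0 -hE; exact: (valP y).
clearbody v.
have [|i' i'E] := @linear_factor_inj R _ _ _ v i vI.
  by move=> x; apply: vP; rewrite hE iE /= linear0 (short_exact_comp0 fg) subrr.
have [|j' j'E] := @linear_factor_inj R _ _ _ v j vI.
  by move=> x; apply: vP; rewrite hE jE /= linear0 (short_exact_comp0 fg') subrr.
exists D, i', (b \o v), j', (a \o v); split.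
- split=> [x y xy|y|y] /=.
  + by apply: inf; move/(congr1 v): xy; rewrite !i'E !iE => -[].
  + rewrite bE; split=> [y0|[x <-]]; last by rewrite i'E iE.
    have /efg[x fx] : g (v y).1 = 0 by rewrite v0 y0 linear0.
    by exists x; apply: vI; rewrite i'E iE fx -y0 -surjective_pairing.
  + have [p gp] := sg (g' y); have [|z zE] := vP (p, y).
      by rewrite hE /= gp subrr.
    by exists z; rewrite bE zE.
- split=> [x y xy|y|y] /=.
  + by apply: inf'; move/(congr1 v): xy; rewrite !j'E !jE => -[].
  + rewrite aE; split=> [y0|[x <-]]; last by rewrite j'E jE.
    have /efg'[x fx] : g' (v y).2 = 0 by rewrite -v0 y0 linear0.
    by exists x; apply: vI; rewrite j'E jE fx -y0 -surjective_pairing.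
  + have [p gp] := sg' (g y); have [|z zE] := vP (y, p).
      by rewrite hE /= gp subrr.
    by exists z; rewrite aE zE.
- by move=> x /=; rewrite aE i'E iE.
- by move=> x /=; rewrite bE j'E jE.
Qed.

(** The pushout of two embeddings of [A] is an extension in two ways, each
    cokernel being that of the opposite embedding. *)
Lemma pushout (A B C F H : lmodType R)
    (f : {linear A -> B}) (g : {linear B -> C})
    (f' : {linear A -> F}) (g' : {linear F -> H}) :
  short_exact f g -> short_exact f' g' ->
  exists (D : lmodType R) (b : {linear B -> D}) (p : {linear D -> H})
         (a : {linear F -> D}) (q : {linear D -> C}),
    short_exact b p /\ short_exact a q.
Proof.
move=> fg fg'; have [inf efg sg] := fg; have [inf' efg' sg'] := fg'.
have [|h hE] := @linear_bundle R A (B * F)%type (fun x => (f x, - f' x)).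
  by move=> c x y /=; rewrite !linearP.
have [|i iE] := @linear_bundle R B (B * F)%type (fun x => (x, 0)).
  by move=> c x y /=; congr pair; rewrite /= scaler0 addr0.
have [|j jE] := @linear_bundle R F (B * F)%type (fun x => (0, x)).
  by move=> c x y /=; congr pair; rewrite /= scaler0 addr0.
have [|a aE] := @linear_bundle R (B * F)%type C (fun z => g z.1).
  by move=> c x y /=; rewrite linearP.
have [|b bE] := @linear_bundle R (B * F)%type H (fun z => g' z.2).
  by move=> c x y /=; rewrite linearP.
pose D := coker h; pose v : {linear (B * F)%type -> D} := coker_pi h.
have v0 z : v z = 0 <-> exists x, h x = z by exact: coker_pi_eq0.
have vS : surjective v by move=> z; exists (repr z); exact: coker_piK.
clearbody v.
have vh z : v z = 0 -> a z = 0 /\ b z = 0.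
  move=> /v0[x <-]; rewrite aE bE hE /= linearN !(short_exact_comp0 fg, short_exact_comp0 fg').
  by rewrite oppr0.
have [a' a'E] := @linear_factor_surj R _ _ _ v a vS (fun z z0 => (vh z z0).1).
have [b' b'E] := @linear_factor_surj R _ _ _ v b vS (fun z z0 => (vh z z0).2).
have vsum x y : v (x, y) = v (i x) + v (j y).
  by rewrite -linearD iE jE; congr (v (_, _)); rewrite /= ?addr0 ?add0r.
have vanti x : v (i (f x)) = v (j (f' x)).
  apply/eqP; rewrite -subr_eq0 -linearB; apply/eqP/v0; exists x.
  by rewrite hE iE jE; congr (_, _); rewrite /= ?subr0 ?sub0r.
exists D, (v \o i), b', (v \o j), a'; split.
- split=> [x y /= /eqP|z|z] /=.
  + rewrite -subr_eq0 -!linearB => /eqP/v0[w]; rewrite hE iE.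
    case=> fw /eqP; rewrite oppr_eq0 -(linear0 f') => /eqP/inf' w0.
    by apply/eqP; rewrite -subr_eq0 -fw w0 linear0.
  + have [[x y] <-] := vS z; rewrite b'E bE /=; split=> [/efg'[w <-]|[w]].
      by exists (x + f w); rewrite 2!linearD /= vanti -vsum.
    move=> wE; have: b (i w) = b (x, y) by rewrite -!b'E wE.
    by rewrite !bE iE linear0 /= => <-.
  + have [y <-] := sg' z; exists (v (j y)).
    by rewrite b'E bE jE.
- split=> [x y /= /eqP|z|z] /=.
  + rewrite -subr_eq0 -!linearB => /eqP/v0[w]; rewrite hE jE.
    case=> /eqP; rewrite -(linear0 f) => /eqP/inf -> /eqP.
    by rewrite linear0 oppr0 eq_sym subr_eq0 => /eqP.
  + have [[x y] <-] := vS z; rewrite a'E aE /=; split=> [/efg[w <-]|[w]].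
      by exists (f' w + y); rewrite 2!linearD /= -vanti -vsum.
    move=> wE; have: a (j w) = a (x, y) by rewrite -!a'E wE.
    by rewrite !aE jE linear0 /= => <-.
  + have [y <-] := sg z; exists (v (i y)).
    by rewrite a'E aE iE.
Qed.

(** The third isomorphism theorem for [A <= B <= C], with the three quotients
    given only up to isomorphism: [B / A -> C / A -> C / B]. *)
Lemma coker_chain (A B C Q1 Q2 Q : lmodType R)
    (f : {linear A -> B}) (g : {linear B -> Q1})
    (f' : {linear B -> C}) (g' : {linear C -> Q2})
    (h : {linear A -> C}) (r : {linear C -> Q}) :
  short_exact f g -> short_exact f' g' -> (forall x, h x = f' (f x)) ->
  short_exact h r ->
  exists (u : {linear Q1 -> Q}) (v : {linear Q -> Q2}), short_exact u v.
Proof.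
move=> [_ fg sg] fg' hE [_ hr sr]; have [inf' efg' sg'] := fg'.
have [|u uE] := @linear_factor_surj R _ _ _ g (r \o f') sg.
  by move=> x /fg[y <-]; rewrite /= -hE; apply/hr; exists y.
have [|v vE] := @linear_factor_surj R _ _ _ r g' sr.
  by move=> x /hr[y <-]; rewrite hE (short_exact_comp0 fg').
exists u, v; split=> [x y|z|z].
- have [x' <-] := sg x; have [y' <-] := sg y; rewrite !uE /= => /eqP.
  rewrite -subr_eq0 -!linearB => /eqP/hr[w]; rewrite hE => /inf' wE.
  by apply/eqP; rewrite -subr_eq0 -linearB; apply/eqP/fg; exists w.
- have [z' <-] := sr z; rewrite vE; split=> [/efg'[y <-]|[x]].
    by exists (g y); rewrite uE.
  by have [x' <-] := sg x; rewrite uE -vE => <-; rewrite /= vE (short_exact_comp0 fg').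
- by have [y <-] := sg' z; exists (r y); rewrite vE.
Qed.

(** The kernels of two composable surjections form a short exact sequence:
    [p] maps the kernel of the composite onto that of [q]. *)
Lemma ker_chain (P B C K A K' : lmodType R)
    (k : {linear K -> P}) (p : {linear P -> B})
    (a : {linear A -> B}) (q : {linear B -> C})
    (k' : {linear K' -> P}) (r : {linear P -> C}) :
  short_exact k p -> short_exact a q -> (forall x, r x = q (p x)) ->
  short_exact k' r ->
  exists (u : {linear K -> K'}) (v : {linear K' -> A}),
    [/\ short_exact u v, forall x, k' (u x) = k x & forall x, a (v x) = p (k' x)].
Proof.
move=> kp aq rE kr; have [ik ekp sp] := kp; have [ia eaq sq] := aq.
have [ik' ekr sr] := kr.
have [|u uE] := @linear_factor_inj R _ _ _ k' k ik'.
  by move=> x; apply/ekr; rewrite rE (short_exact_comp0 kp) linear0.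
have [|v vE] := @linear_factor_inj R _ _ _ a (p \o k') ia.
  by move=> x; apply/eaq; rewrite /= -rE (short_exact_comp0 kr).
exists u, v; split=> //; split=> [x y xy|z|z].
- by apply: ik; rewrite -!uE xy.
- split=> [vz|[x <-]].
    have /ekp[x kx] : p (k' z) = 0 by rewrite -[p _]vE vz linear0.
    by exists x; apply: ik'; rewrite uE.
  by apply: ia; rewrite vE /= uE (short_exact_comp0 kp) linear0.
- have [y py] := sp (a z); have /ekr[w kw] : r y = 0.
    by rewrite rE py (short_exact_comp0 aq).
  by exists w; apply: ia; rewrite vE /= kw.
Qed.

End ShortExactSequences.

(** * Free modules and generators of the tensor product *)

Section FreeModules.
Variables (S : pzRingType) (X : choiceType).

Lemma free_support (u : free S X) :
  exists2 s : seq X, uniq s & forall x, val u x != 0 -> x \in s.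
Proof.
have [s sE] := (finite_seqP _).1 (free_finite_support u).
exists (undup s); first exact: undup_uniq.
move=> x ux; rewrite mem_undup; suff: [set` s]%classic x by [].
by rewrite -sE.
Qed.

Lemma free_scaleE (a : S) (u : free S X) (x : X) :
  val (a *: u) x = a * (val u x : S).
Proof. by []. Qed.

Lemma free_expand (u : free S X) (s : seq X) :
  uniq s -> (forall x, val u x != 0 -> x \in s) ->
  u = \sum_(x <- s) (val u x : S) *: free_basis S x.
Proof.
move=> us hs; apply: val_inj; rewrite raddf_sum /=; apply/funext => y.
rewrite fct_sumE.
have E i : val ((val u i : S) *: free_basis S i) y = if y == i then val u y else 0.
  rewrite -[LHS]/((val u i : S) * (if y == i then 1 else 0)).
  by case: eqP => [->|_]; rewrite ?mulr1 ?mulr0.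
rewrite (eq_bigr _ (fun i _ => E i)) -big_mkcond /=.
have [ys|ys] := boolP (y \in s); last first.
  rewrite big1_seq => [|i /andP[/eqP <-]]; last by rewrite (negPf ys).
  by apply/eqP; apply: contraNT ys => /hs.
by rewrite (big_rem y) //= eqxx big1_seq ?addr0 // => i /andP[/eqP <-];
   rewrite mem_rem_uniqF.
Qed.

Lemma free_linear_ext (N : lmodType S) (f g : {linear free S X -> N}) :
  (forall x, f (free_basis S x) = g (free_basis S x)) -> forall u, f u = g u.
Proof.
move=> fg u; have [s us hs] := free_support u.
rewrite (free_expand us hs) !linear_sum; apply: eq_bigr => x _.
by rewrite !linearZ_LR /= fg.
Qed.

End FreeModules.

(** A subgroup of a free abelian group that contains a basis is everything;
    this is what makes pure tensors generate. *)
Lemma free_int_ind (X : choiceType) (P : free int X -> Prop) :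
  P 0 -> (forall x, P (free_basis int x)) ->
  (forall u v, P u -> P v -> P (u - v)) -> forall u, P u.
Proof.
move=> P0 Pb PB u.
have PN v : P v -> P (- v) by move=> Pv; rewrite -sub0r; exact: PB.
have PD v w : P v -> P w -> P (v + w).
  by move=> Pv Pw; rewrite -[w]opprK; apply: PB => //; exact: PN.
have Pn v n : P v -> P (v *+ n).
  by move=> Pv; elim: n => [|n IHn]; rewrite ?mulr0n // mulrS; exact: PD.
have Pz (a : int) v : P v -> P (a *: v).
  move=> Pv; rewrite -[a]intz scaler_int.
  by case: a => n; rewrite /intmul; [|apply: PN]; exact: Pn.
have [s us hs] := free_support u; rewrite (free_expand us hs).
by elim: s {us hs} => [|x s IHs]; rewrite ?big_nil // big_cons; apply: PD => //; apply: Pz.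
Qed.

Section TensorGenerators.
Variables (R : pzRingType) (E : lmodType R^c) (M : lmodType R).
Local Notation "x *t y" := (@pure_tensor R E M x y) (at level 40).

Lemma tensor_ind (P : tensor E M -> Prop) :
  P 0 -> (forall x y, P (x *t y)) ->
  (forall s t, P s -> P t -> P (s - t)) -> forall t, P t.
Proof.
move=> P0 Pp PB t; rewrite -[t]reprK -[(\pi _)%qT]/(to_tensor (repr t)).
elim/free_int_ind: (repr t) => [|[x y]|u v Pu Pv]; last 2 first.
- exact: Pp.
- by rewrite to_tensorB; exact: PB.
- by have := to_tensorB (0 : free int (E * M)%type) 0; rewrite !subrr => ->.
Qed.

Lemma tensor_ext (Z : zmodType) (f g : {additive tensor E M -> Z}) :
  (forall x y, f (x *t y) = g (x *t y)) -> forall t, f t = g t.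
Proof.
move=> fg; elim/tensor_ind => [|//|s t fs ft]; first by rewrite !raddf0.
by rewrite !raddfB fs ft.
Qed.

Lemma pure_tensorDl x x' y : (x + x') *t y = x *t y + x' *t y.
Proof.
apply/eqP; rewrite -subr_eq0 opprD addrA -!to_tensorB; apply/eqP.
have <- : to_tensor (0 : free int (E * M)%type) = 0.
  by have := to_tensorB (0 : free int (E * M)%type) 0; rewrite !subrr.
by apply/to_tensor_eq; rewrite subr0; apply/zspan_gen/relator_addl.
Qed.

Lemma pure_tensorDr x y y' : x *t (y + y') = x *t y + x *t y'.
Proof.
apply/eqP; rewrite -subr_eq0 opprD addrA -!to_tensorB; apply/eqP.
have <- : to_tensor (0 : free int (E * M)%type) = 0.
  by have := to_tensorB (0 : free int (E * M)%type) 0; rewrite !subrr.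
by apply/to_tensor_eq; rewrite subr0; apply/zspan_gen/relator_addr.
Qed.

Lemma pure_tensorZ (r : R) x y : ((r : R^c) *: x) *t y = x *t (r *: y).
Proof. by apply/to_tensor_eq/zspan_gen/relator_bal. Qed.

Lemma pure_tensor0r x : x *t 0 = 0.
Proof. by apply: (@addrI _ (x *t 0)); rewrite -pure_tensorDr !addr0. Qed.

Lemma pure_tensor0l y : 0 *t y = 0.
Proof. by apply: (@addrI _ (0 *t y)); rewrite -pure_tensorDl !addr0. Qed.

Lemma pure_tensor_sumr (I : Type) (s : seq I) x (F : I -> M) :
  x *t (\sum_(i <- s) F i) = \sum_(i <- s) x *t F i.
Proof.
by elim: s => [|i s IHs]; rewrite ?big_nil ?pure_tensor0r // !big_cons pure_tensorDr IHs.
Qed.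

Lemma pure_tensor_suml (I : Type) (s : seq I) (F : I -> E) y :
  (\sum_(i <- s) F i) *t y = \sum_(i <- s) F i *t y.
Proof.
by elim: s => [|i s IHs]; rewrite ?big_nil ?pure_tensor0l // !big_cons pure_tensorDl IHs.
Qed.

(** The universal property: the linear extension of [b] to the free abelian
    group on [E * M] kills the relators. *)
Lemma tensor_lift (Z : zmodType) (b : E -> M -> Z) :
  (forall x x' y, b (x + x') y = b x y + b x' y) ->
  (forall x y y', b x (y + y') = b x y + b x y') ->
  (forall (r : R) x y, b ((r : R^c) *: x) y = b x (r *: y)) ->
  exists T : {additive tensor E M -> Z}, forall x y, T (x *t y) = b x y.
Proof.
move=> bDl bDr bZ.
pose L := @free_lift int (E * M)%type (zmodule Z) (fun p => b p.1 p.2).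
have L0 u : zspan (@tensor_relator R E M) u -> L u = 0.
  elim=> {u} [|u [x x' y|x y y'|r x y]|u v _ IHu _ IHv].
  - exact: linear0.
  - rewrite /L !linearB /= !free_lift_basis /= bDl.
    by rewrite -[b x y]/(b x y : zmodule Z) addrAC addrK subrr.
  - rewrite /L !linearB /= !free_lift_basis /= bDr.
    by rewrite -[b x y]/(b x y : zmodule Z) addrAC addrK subrr.
  - by rewrite /L linearB /= !free_lift_basis /= bZ subrr.
  - by rewrite /L linearB /= -/L IHu IHv subrr.
have Lt u : L (repr (to_tensor u)) = L u.
  apply/eqP; rewrite -subr_eq0 -linearB; apply/eqP/L0/to_tensor_eq.
  by rewrite /to_tensor reprK.
pose f (t : tensor E M) : Z := L (repr t).
have fB : zmod_morphism f.
  move=> s t.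
  have [u ->] : exists u, s = to_tensor u by exists (repr s); rewrite /to_tensor reprK.
  have [v ->] : exists v, t = to_tensor v by exists (repr t); rewrite /to_tensor reprK.
  by rewrite -to_tensorB /f !Lt /L linearB.
pose m := GRing.isZmodMorphism.Build (tensor E M) Z f fB.
pose T : {additive tensor E M -> Z} := HB.pack f m.
by exists T => x y; rewrite -[LHS]/(L _) Lt /L free_lift_basis.
Qed.

End TensorGenerators.

(** * Right exactness of the tensor product and flatness of free modules *)

Local Notation tensorr E f := (tensor_map (idfun : {linear E -> E}) f).
Local Notation tensorl f M := (tensor_map f (idfun : {linear M -> M})).

Section TensorMaps.
Variable R : pzRingType.
Implicit Types (E : lmodType R^c) (M : lmodType R).

Lemma tensor_map_comp E1 E2 E3 M1 M2 M3
    (f : {linear E1 -> E2}) (g : {linear E2 -> E3}) (h : {linear E1 -> E3})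
    (f' : {linear M1 -> M2}) (g' : {linear M2 -> M3}) (h' : {linear M1 -> M3}) :
  (forall x, g (f x) = h x) -> (forall y, g' (f' y) = h' y) ->
  forall t, tensor_map g g' (tensor_map f f' t) = tensor_map h h' t.
Proof.
move=> gf gf' t.
apply: (@tensor_ext R E1 M1 _ (tensor_map g g' \o tensor_map f f')) => x y /=.
by rewrite !tensor_map_pure gf gf'.
Qed.

Lemma tensor_map_eq0 E E' M M' (f : {linear E -> E'}) (g : {linear M -> M'}) :
  (forall x y, pure_tensor (f x) (g y) = 0) -> forall t, tensor_map f g t = 0.
Proof.
move=> fg0 t; apply: (@tensor_ext R E M _ (tensor_map f g) \0) => x y /=.
by rewrite tensor_map_pure fg0.
Qed.

Lemma tensorr_comp E M1 M2 M3 (f : {linear M1 -> M2}) (g : {linear M2 -> M3})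
    (h : {linear M1 -> M3}) : (forall y, g (f y) = h y) ->
  forall t, tensorr E g (tensorr E f t) = tensorr E h t.
Proof. by move=> gf; apply: tensor_map_comp. Qed.

Lemma tensorl_comp E1 E2 E3 M (f : {linear E1 -> E2}) (g : {linear E2 -> E3})
    (h : {linear E1 -> E3}) : (forall y, g (f y) = h y) ->
  forall t, tensorl g M (tensorl f M t) = tensorl h M t.
Proof. by move=> gf; apply: tensor_map_comp. Qed.

Lemma tensor_swap E E' M M' (f : {linear E -> E'}) (g : {linear M -> M'}) t :
  tensorl f M' (tensorr E g t) = tensorr E' g (tensorl f M t).
Proof.
apply: (@tensor_ext R E M _ (tensorl f M' \o tensorr E g)
  (tensorr E' g \o tensorl f M)) => x y /=.
by rewrite !tensor_map_pure.
Qed.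

Lemma tensorr_surj E M M' (g : {linear M -> M'}) :
  surjective g -> surjective (tensorr E g).
Proof.
move=> sg; elim/tensor_ind => [|x y|s t [s' <-] [t' <-]].
- by exists 0; rewrite raddf0.
- by have [z <-] := sg y; exists (pure_tensor x z); rewrite tensor_map_pure.
- by exists (s' - t'); rewrite raddfB.
Qed.

Lemma tensorl_surj E E' M (f : {linear E -> E'}) :
  surjective f -> surjective (tensorl f M).
Proof.
move=> sf; elim/tensor_ind => [|x y|s t [s' <-] [t' <-]].
- by exists 0; rewrite raddf0.
- by have [z <-] := sf x; exists (pure_tensor z y); rewrite tensor_map_pure.
- by exists (s' - t'); rewrite raddfB.
Qed.

End TensorMaps.

Section ImageQuotient.
Variables (W X : zmodType) (f : {additive W -> X}).

(** A quotient of abelian groups, known only through its kernel; the map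
    built in the proof of right exactness takes its values in it. *)
Lemma additive_coker_exists :
  exists (Q : zmodType) (q : {additive X -> Q}),
    forall x, q x = 0 <-> exists w, f w = x.
Proof.
pose I := zspan_closed (fun x => exists w, f w = x).
exists (Quotient.quot I), (\pi_(Quotient.quot I)%qT : {additive X -> _}) => x.
rewrite -(raddf0 (\pi_(Quotient.quot I)%qT : {additive X -> _})); split.
  move/eqP; rewrite /= -Quotient.idealrBE subr0 => /asboolP.
  elim=> [|//|y z _ [a <-] _ [b <-]]; first by exists 0; rewrite raddf0.
  by exists (a - b); rewrite raddfB.
move=> fx; apply/eqP; rewrite /= -Quotient.idealrBE subr0; apply/asboolP.
exact: zspan_gen.
Qed.

End ImageQuotient.

Section RightExactness.
Variable R : pzRingType.

(** Right exactness.  Choosing preimages under [g] gives a balanced map from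
    [E * C] to the cokernel of [E (x) f], hence a map on [E (x) C] through
    which the projection of [E (x) B] to that cokernel factors. *)
Lemma tensorr_exact (E : lmodType R^c) (A B C : lmodType R)
    (f : {linear A -> B}) (g : {linear B -> C}) :
  exact f g -> surjective g -> exact (tensorr E f) (tensorr E g).
Proof.
move=> fg sg t; split=> [|[s <-]]; last first.
  rewrite (@tensorr_comp R E _ _ _ f g \0); last by move=> y /=; apply/fg; exists y.
  by apply: tensor_map_eq0 => x y; rewrite /= pure_tensor0r.
have [Q [q qE]] := additive_coker_exists (tensorr E f).
have [s sK] : exists s : C -> B, forall y, g (s y) = y.
  by exists (fun y => sval (cid (sg y))) => y; case: cid.
have qg x b b' : g b = g b' -> q (pure_tensor x b) = q (pure_tensor x b').
  move=> bb'; have /fg[a ab] : g (b - b') = 0 by rewrite linearB bb' subrr.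
  rewrite -[b](subrK b') pure_tensorDr raddfD -ab.
  have /qE -> : exists w, tensorr E f w = pure_tensor x (f a).
    by exists (pure_tensor x a); rewrite tensor_map_pure.
  by rewrite add0r.
have [|||T TE] := @tensor_lift R E C Q (fun x c => q (pure_tensor x (s c))).
- by move=> x x' y; rewrite pure_tensorDl raddfD.
- move=> x y y'; rewrite -raddfD -pure_tensorDr; apply: qg.
  by rewrite linearD !sK.
- by move=> r x y; rewrite pure_tensorZ; apply: qg; rewrite linearZ_LR !sK.
have Tg u : T (tensorr E g u) = q u.
  apply: (@tensor_ext R E B Q (T \o tensorr E g) q) => x y /=.
  by rewrite tensor_map_pure TE; apply: qg; rewrite sK.
by move=> gt0; apply/qE; rewrite -Tg gt0 raddf0.
Qed.

Lemma tensorl_exact (M : lmodType R) (A B C : lmodType R^c)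
    (f : {linear A -> B}) (g : {linear B -> C}) :
  exact f g -> surjective g -> exact (tensorl f M) (tensorl g M).
Proof.
move=> fg sg t; split=> [|[s <-]]; last first.
  rewrite (@tensorl_comp R _ _ _ M f g \0); last by move=> y /=; apply/fg; exists y.
  by apply: tensor_map_eq0 => x y; rewrite /= pure_tensor0l.
have [Q [q qE]] := additive_coker_exists (tensorl f M).
have [s sK] : exists s : C -> B, forall y, g (s y) = y.
  by exists (fun y => sval (cid (sg y))) => y; case: cid.
have qg b b' y : g b = g b' -> q (pure_tensor b y) = q (pure_tensor b' y).
  move=> bb'; have /fg[a ab] : g (b - b') = 0 by rewrite linearB bb' subrr.
  rewrite -[b](subrK b') pure_tensorDl raddfD -ab.
  have /qE -> : exists w, tensorl f M w = pure_tensor (f a) y.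
    by exists (pure_tensor a y); rewrite tensor_map_pure.
  by rewrite add0r.
have [|||T TE] := @tensor_lift R C M Q (fun c y => q (pure_tensor (s c) y)).
- move=> x x' y; rewrite -raddfD -pure_tensorDl; apply: qg.
  by rewrite linearD !sK.
- by move=> x y y'; rewrite pure_tensorDr raddfD.
- by move=> r x y; rewrite -pure_tensorZ; apply: qg; rewrite linearZ_LR !sK.
have Tg u : T (tensorl g M u) = q u.
  apply: (@tensor_ext R B M Q (T \o tensorl g M) q) => x y /=.
  by rewrite tensor_map_pure TE; apply: qg; rewrite sK.
by move=> gt0; apply/qE; rewrite -Tg gt0 raddf0.
Qed.

End RightExactness.

Lemma converse_mulE (R : pzRingType) (a b : R^c) : a * b = (b : R) * (a : R).
Proof. by []. Qed.

Section FreeFlat.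
Variables (R : pzRingType) (X : choiceType).

(** [E (x) R^(X)] is the direct sum of copies of [E]: a tensor [t] is the sum
    of the [c x t (x) x] over a finite set of basis elements, so the coordinate
    maps detect zero. *)
Lemma tensor_free_coord (E : lmodType R^c) :
  exists c : X -> {additive tensor E (free R X) -> E},
    (forall x e u, c x (pure_tensor e u) = (val u x : R^c) *: e) /\
    (forall t, (forall x, c x t = 0) -> t = 0).
Proof.
have cx x : {c : {additive tensor E (free R X) -> E} |
    forall e u, c (pure_tensor e u) = (val u x : R^c) *: e}.
  apply: cid; apply: (@tensor_lift R E (free R X) E
    (fun e u => (val u x : R^c) *: e)) => [e e' u|e u u'|r e u].
  - exact: scalerDr.
  - exact: scalerDl.
  - by rewrite scalerA.
exists (fun x => sval (cx x)); split=> [x|t t0]; first exact: (svalP (cx x)).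
have [s0 H] : exists s0 : seq X, forall s, uniq s -> {subset s0 <= s} ->
    t = \sum_(x <- s) pure_tensor (sval (cx x) t) (free_basis R x).
  elim/tensor_ind: t {t0} => [|e u|t t' [s1 IH1] [s2 IH2]].
  - by exists [::] => s _ _; rewrite big1 // => x _; rewrite raddf0 pure_tensor0l.
  - have [s1 _ h1] := free_support u; exists s1 => s us ss.
    rewrite {1}(free_expand us (fun x ux => ss x (h1 x ux))) pure_tensor_sumr.
    by apply: eq_bigr => x _; rewrite (svalP (cx x)) pure_tensorZ.
  - exists (s1 ++ s2) => s us ss.
    rewrite {1}(IH1 s us) => [|x xs]; last by apply: ss; rewrite mem_cat xs.
    rewrite {1}(IH2 s us) => [|x xs]; last by apply: ss; rewrite mem_cat xs orbT.
    rewrite -sumrB; apply: eq_bigr => x _.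
    by rewrite raddfB /=; apply/eqP; rewrite subr_eq -pure_tensorDl subrK.
rewrite (H (undup s0)) ?undup_uniq // => [|x]; last by rewrite mem_undup.
by rewrite big1 // => x _; rewrite t0 pure_tensor0l.
Qed.

Lemma free_tensor_coord (M : lmodType R) :
  exists c : X -> {additive tensor (free R^c X) M -> M},
    (forall x u m, c x (pure_tensor u m) = (val u x : R) *: m) /\
    (forall t, (forall x, c x t = 0) -> t = 0).
Proof.
have cx x : {c : {additive tensor (free R^c X) M -> M} |
    forall u m, c (pure_tensor u m) = (val u x : R) *: m}.
  apply: cid; apply: (@tensor_lift R (free R^c X) M M
    (fun u m => (val u x : R) *: m)) => [u u' m|u m m'|r u m].
  - exact: scalerDl.
  - exact: scalerDr.
  - by rewrite (free_scaleE (S := R^c)) converse_mulE -scalerA.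
exists (fun x => sval (cx x)); split=> [x|t t0]; first exact: (svalP (cx x)).
have [s0 H] : exists s0 : seq X, forall s, uniq s -> {subset s0 <= s} ->
    t = \sum_(x <- s) pure_tensor (free_basis R^c x) (sval (cx x) t).
  elim/tensor_ind: t {t0} => [|u m|t t' [s1 IH1] [s2 IH2]].
  - by exists [::] => s _ _; rewrite big1 // => x _; rewrite raddf0 pure_tensor0r.
  - have [s1 _ h1] := free_support u; exists s1 => s us ss.
    rewrite {1}(free_expand us (fun x ux => ss x (h1 x ux))) pure_tensor_suml.
    by apply: eq_bigr => x _; rewrite (svalP (cx x)) pure_tensorZ.
  - exists (s1 ++ s2) => s us ss.
    rewrite {1}(IH1 s us) => [|x xs]; last by apply: ss; rewrite mem_cat xs.
    rewrite {1}(IH2 s us) => [|x xs]; last by apply: ss; rewrite mem_cat xs orbT.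
    rewrite -sumrB; apply: eq_bigr => x _.
    by rewrite raddfB /=; apply/eqP; rewrite subr_eq -pure_tensorDr subrK.
rewrite (H (undup s0)) ?undup_uniq // => [|x]; last by rewrite mem_undup.
by rewrite big1 // => x _; rewrite t0 pure_tensor0r.
Qed.

(** Coordinates commute with [f (x) R^(X)], so this map is injective as soon
    as [f] is, coordinate by coordinate. *)
Lemma tensorl_free_inj (A B : lmodType R^c) (f : {linear A -> B}) :
  injective f -> injective (tensorl f (free R X)).
Proof.
move=> inf; apply: raddf_inj => t ft0.
have [c [cE c0]] := tensor_free_coord A; have [d [dE _]] := tensor_free_coord B.
apply: c0 => x; apply: inf; rewrite raddf0.
suff <- : d x (tensorl f (free R X) t) = f (c x t) by rewrite ft0 raddf0.
apply: (@tensor_ext R A (free R X) B (d x \o tensorl f (free R X)) (f \o c x)).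
by move=> e u /=; rewrite tensor_map_pure dE cE linearZ_LR.
Qed.

Lemma tensorr_free_inj (A B : lmodType R) (f : {linear A -> B}) :
  injective f -> injective (tensorr (free R^c X) f).
Proof.
move=> inf; apply: raddf_inj => t ft0.
have [c [cE c0]] := free_tensor_coord A; have [d [dE _]] := free_tensor_coord B.
apply: c0 => x; apply: inf; rewrite raddf0.
suff <- : d x (tensorr (free R^c X) f t) = f (c x t) by rewrite ft0 raddf0.
apply: (@tensor_ext R (free R^c X) A B (d x \o tensorr (free R^c X) f) (f \o c x)).
by move=> e u /=; rewrite tensor_map_pure dE cE linearZ_LR.
Qed.

End FreeFlat.

Arguments tensorr_exact {R} E {A B C f g}.
Arguments tensorl_exact {R} M {A B C f g}.
Arguments tensorr_surj {R} E {M M' g}.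
Arguments tensorl_surj {R E E'} M {f}.

(** * Flatness and the vanishing of Tor *)

Section Flat.
Variable R : pzRingType.

Lemma short_exact_free (M : lmodType R) :
  short_exact (res_incl M 0) (free_eval M).
Proof.
by apply: lker_short_exact => x; exists (free_basis R x); apply: free_lift_basis.
Qed.

(** Right exactness reduces exactness in the middle to the injectivity of the
    inclusion of the image of [g]. *)
Lemma tensorl_exact_of_inj (M : lmodType R) (A B C : lmodType R^c)
    (f : {linear A -> B}) (g : {linear B -> C}) :
  (forall (X Y : lmodType R^c) (h : {linear X -> Y}),
      injective h -> injective (tensorl h M)) ->
  exact f g -> exact (tensorl f M) (tensorl g M).
Proof.
move=> Minj fg t; split=> [gt0|[s <-]]; last first.
  rewrite (@tensorl_comp R _ _ _ M f g \0); last by move=> y /=; apply/fg; exists y.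
  by apply: tensor_map_eq0 => x y; rewrite /= pure_tensor0l.
have [p [i [sp ii pE]]] := limage_factor g.
have fp : exact f p.
  move=> b; rewrite -fg; split=> [pb|gb]; first by rewrite -pE pb linear0.
  by apply: ii; rewrite pE gb linear0.
apply/(tensorl_exact M fp sp); apply: (Minj _ _ i ii).
by rewrite (tensorl_comp pE) gt0 raddf0.
Qed.

Lemma flatP (M : lmodType R) : flat M <->
  forall (X Y : lmodType R^c) (h : {linear X -> Y}),
      injective h -> injective (tensorl h M).
Proof.
split=> [fM X Y h hi|hM A B C f g]; last exact: tensorl_exact_of_inj.
apply: raddf_inj => t /(fM X X Y \0 h)[].
  move=> b; split=> [hb|[a <-]]; last exact: linear0.
  by exists 0; apply: hi; rewrite hb linear0.
by move=> s <-; apply: tensor_map_eq0 => x y; rewrite /= pure_tensor0l.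
Qed.

Lemma free_flat (X : choiceType) : flat (free R X).
Proof. by apply/flatP => A B h hi; apply: tensorl_free_inj. Qed.

End Flat.

(** The chase behind the symmetry of Tor, in a diagram with rows [a], [b], [c]
    and columns [u], [v]: an element of [X13] killed by [u3] is lifted to [X12],
    pushed to [X22], and traced back to [X21] and [X11]. *)
Lemma nine_injective (X11 X12 X13 X21 X22 X23 X31 X32 : zmodType)
    (a1 : {additive X11 -> X12}) (a2 : {additive X12 -> X13})
    (b1 : {additive X21 -> X22}) (b2 : {additive X22 -> X23})
    (c1 : {additive X31 -> X32})
    (u1 : {additive X11 -> X21}) (v1 : {additive X21 -> X31})
    (u2 : {additive X12 -> X22}) (v2 : {additive X22 -> X32})
    (u3 : {additive X13 -> X23}) :
  (forall x, b1 (u1 x) = u2 (a1 x)) -> (forall x, b2 (u2 x) = u3 (a2 x)) ->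
  (forall x, c1 (v1 x) = v2 (b1 x)) ->
  (forall x, a2 (a1 x) = 0) -> surjective a2 -> exact b1 b2 ->
  exact u1 v1 -> (forall x, v2 (u2 x) = 0) ->
  injective u2 -> injective c1 -> injective u3.
Proof.
move=> bu1 bu2 cv a21 sa eb eu v2u2 iu ic; apply: raddf_inj => t.
have [t' <-] := sa t; rewrite -bu2 => /eb[s sE].
have /eu[r rE] : v1 s = 0 by apply: ic; rewrite cv sE v2u2 raddf0.
suff <- : a1 r = t' by rewrite a21.
by apply: iu; rewrite -bu1 rE sE.
Qed.

Section TorOne.
Variable R : pzRingType.
Implicit Types (E : lmodType R^c) (N : lmodType R).

(** The vanishing of [Tor 1 E N], without choosing a resolution of either
    module. *)
Definition tor1_zero E N : Prop :=
  forall (A B : lmodType R) (f : {linear A -> B}) (g : {linear B -> N}),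
    short_exact f g -> injective (tensorr E f).

Lemma tensorr_comp0 E (A B C : lmodType R) (f : {linear A -> B})
    (g : {linear B -> C}) : short_exact f g ->
  forall t, tensorr E g (tensorr E f t) = 0.
Proof. by move=> [_ fg sg] t; apply/(tensorr_exact E fg sg); exists t. Qed.

Lemma tensorl_comp0 N (A B C : lmodType R^c) (f : {linear A -> B})
    (g : {linear B -> C}) : short_exact f g ->
  forall t, tensorl g N (tensorl f N t) = 0.
Proof. by move=> [_ fg sg] t; apply/(tensorl_exact N fg sg); exists t. Qed.

Arguments tensorr_comp0 E {A B C f g} _ t.
Arguments tensorl_comp0 N {A B C f g} _ t.

(** Half of the symmetry of Tor: [tor1_zero E N] also controls presentations of
    [E].  It is the nine lemma for the given sequence and a free presentation
    of [N]. *)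
Lemma tor1_zero_inj_l E N (L F : lmodType R^c)
    (f : {linear L -> F}) (g : {linear F -> E}) :
  tor1_zero E N -> short_exact f g -> injective (tensorl f N).
Proof.
move=> EN fg; have [inf efg sg] := fg.
have kp := short_exact_free N; have [_ ekp sp] := kp.
apply: (@nine_injective _ _ _ _ _ _ _ _
  (tensorr L (res_incl N 0)) (tensorr L (free_eval N))
  (tensorr F (res_incl N 0)) (tensorr F (free_eval N))
  (tensorr E (res_incl N 0))
  (tensorl f _) (tensorl g _) (tensorl f _) (tensorl g _)).
- by move=> x; apply/esym/tensor_swap.
- by move=> x; apply/esym/tensor_swap.
- by move=> x; apply/esym/tensor_swap.
- exact: tensorr_comp0.
- exact: tensorr_surj.
- exact: tensorr_exact.
- exact: tensorl_exact.
- exact: tensorl_comp0.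
- exact: tensorl_free_inj.
- exact: (EN _ _ _ _ kp).
Qed.

(** The other half of the symmetry: one free presentation of [E] suffices. *)
Lemma tor1_zero_of_l E N (L : lmodType R^c) (X : choiceType)
    (f : {linear L -> free R^c X}) (g : {linear free R^c X -> E}) :
  short_exact f g -> injective (tensorl f N) -> tor1_zero E N.
Proof.
move=> fg fN A B k p kp; have [_ efg sg] := fg; have [ik ekp sp] := kp.
apply: (@nine_injective _ _ _ _ _ _ _ _
  (tensorl f A) (tensorl g A) (tensorl f B) (tensorl g B) (tensorl f N)
  (tensorr _ k) (tensorr _ p) (tensorr _ k) (tensorr _ p)) => //.
- exact: tensor_swap.
- exact: tensor_swap.
- exact: tensor_swap.
- exact: tensorl_comp0.
- exact: tensorl_surj.
- exact: tensorl_exact.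
- exact: tensorr_exact.
- exact: tensorr_comp0.
- exact: tensorr_free_inj.
Qed.

(** One presentation of [N] suffices when its middle term is acyclic: compare
    it with any other one by means of their pullback [D].  An element of
    [E (x) A] killed in [E (x) B] comes, inside [E (x) D], from [E (x) K], where it
    vanishes because [E (x) K] embeds in [E (x) P]. *)
Lemma tor1_zero_of_r E (K P N : lmodType R)
    (f : {linear K -> P}) (g : {linear P -> N}) :
  short_exact f g -> tor1_zero E P -> injective (tensorr E f) -> tor1_zero E N.
Proof.
move=> fg EP fE A B f' g' fg'.
have [D [i [b [j [a [ib ja aiE bjE]]]]]] := pullback fg fg'.
apply: raddf_inj => t t0; apply: (EP _ _ _ _ ja).
have [_ eib sb] := ib.
have /(tensorr_exact E eib sb)[s sE] : tensorr E b (tensorr E j t) = 0.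
  by rewrite (tensorr_comp bjE).
rewrite raddf0 -sE; suff -> : s = 0 by rewrite raddf0.
by apply: fE; rewrite raddf0 -(tensorr_comp aiE) sE (tensorr_comp0 E ja).
Qed.

Lemma flat_tor1_zero E P : flat P -> tor1_zero E P.
Proof.
move=> /flatP fP; apply: (tor1_zero_of_l (short_exact_free E)).
by apply: fP; have [] := short_exact_free E.
Qed.

Lemma tor1_zero_flat Q : (forall E, tor1_zero E Q) -> flat Q.
Proof.
move=> EQ; apply/flatP => X Y h hi.
exact: (tor1_zero_inj_l (EQ _) (coker_short_exact hi)).
Qed.

(** For a surjection from [P] onto [B], the embedding of its kernel in [P]
    factors through the kernel of [P -> B -> C], and the two factors are
    controlled by [A] and by [C]. *)
Lemma tor1_zero_ext E (A B C : lmodType R)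
    (f : {linear A -> B}) (g : {linear B -> C}) :
  short_exact f g -> tor1_zero E A -> tor1_zero E C -> tor1_zero E B.
Proof.
move=> fg EA EC K P k p kp.
have [_ efg sg] := fg; have [_ ekp sp] := kp.
have sgp : surjective (g \o p).
  by move=> z; have [y <-] := sg z; have [x <-] := sp y; exists x.
have kgp := lker_short_exact sgp.
have [u [v [uv uE vE]]] := ker_chain (r := g \o p) kp fg (fun x => erefl) kgp.
move=> s t; rewrite -!(tensorr_comp uE) => /(EC _ _ _ _ kgp).
exact: (EA _ _ _ _ uv).
Qed.

(** In the square with corners [L (x) A], [L (x) B], [F (x) A] and [F (x) B],
    where [F] is the free module, the two maps into [F (x) B] are injective;
    hence the two maps out of [L (x) A] are injective together.  Through
    syzygies of [E] this is dimension shifting in the second variable. *)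
Lemma tor1_zero_shift E (L : lmodType R^c) (X : choiceType)
    (k : {linear L -> free R^c X}) (p : {linear free R^c X -> E})
    (A B C : lmodType R) (f : {linear A -> B}) (g : {linear B -> C}) :
  short_exact k p -> short_exact f g -> tor1_zero E B -> tor1_zero L B ->
  tor1_zero L C <-> tor1_zero E A.
Proof.
move=> kp fg EB LB; have [inf _ _] := fg; split=> [LC|EA].
  apply: (tor1_zero_of_l kp) => s t /(congr1 (tensorr _ f)).
  rewrite -!tensor_swap => /(tor1_zero_inj_l EB kp).
  exact: (LC _ _ _ _ fg).
apply: (tor1_zero_of_r fg LB) => s t /(congr1 (tensorl k B)).
rewrite !tensor_swap => /(tensorr_free_inj inf).
exact: (tor1_zero_inj_l EA kp).
Qed.

End TorOne.

Section Tor.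
Variable R : pzRingType.
Implicit Types (E : lmodType R^c) (M N : lmodType R).

Lemma syzygyS (S : pzRingType) (i : nat) (N : lmodType S) :
  syzygy i (syzygy 1 N) = syzygy i.+1 N.
Proof. by elim: i => //= i ->. Qed.

(** Tor may be computed by shifting either variable; this is the shift along
    the free presentations of [E] and of [syzygy i M]. *)
Lemma tor1_zero_syzygy i E M :
  tor1_zero E (syzygy i M) <-> tor1_zero (syzygy i E) M.
Proof.
elim: i E => [//|i IHi] E; rewrite -[syzygy i.+1 E]syzygyS -IHi.
apply: iff_sym; apply: (tor1_zero_shift (short_exact_free E)
  (short_exact_free (syzygy i M))); apply: flat_tor1_zero; exact: free_flat.
Qed.

Lemma homology_trivial (A B C : zmodType) (f : {additive A -> B})
    (g : {additive B -> C}) :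
  trivial_module (homology f g) <->
  forall b, g b = 0 -> exists a, f a = b.
Proof.
split=> [tr b gb|fg z].
  have kb : ker_pred g b by apply/eqP.
  pose z : ker g := exist (fun x => ker_pred g x) b kb.
  have : (\pi_(homology f g) z = \pi_(homology f g) 0)%qT by rewrite [LHS]tr [RHS]tr.
  by move/eqP; rewrite -Quotient.idealrBE subr0 => /asboolP.
rewrite -[z]reprK -(raddf0 (\pi_(homology f g)%qT : {additive ker g -> _})) /=.
apply/eqP; rewrite -Quotient.idealrBE subr0; apply/asboolP.
by apply: fg; exact/eqP/(valP (repr z)).
Qed.

(** The differentials of the canonical resolution factor through the syzygies,
    and tensoring with [E] is right exact; so the homology in degree [i.+1]
    vanishes exactly when the [(i.+1)]-st syzygy stays embedded in degree
    [i]. *)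
Lemma Tor_trivial_syzygy i E M :
  trivial_module (Tor i.+1 E M) <-> tor1_zero E (syzygy i M).
Proof.
have SE j : short_exact (res_incl M j) (free_eval (syzygy j M)).
  exact: short_exact_free.
have diffE j t : tensor_res_diff E M j t =
    tensorr E (res_incl M j) (tensorr E (free_eval (syzygy j.+1 M)) t).
  by symmetry; apply: tensorr_comp.
have [_ ex su] := SE i.+1; have exT := tensorr_exact E ex su.
have suT := tensorr_surj E su.
apply: iff_trans (homology_trivial _ _) _; split=> [tr|tz].
  apply: (tor1_zero_of_r (SE i)); first exact/flat_tor1_zero/free_flat.
  apply: raddf_inj => t; have [s <-] := suT t => st.
  have /tr[r] : tensor_res_diff E M i s = 0 by rewrite diffE.
  by rewrite diffE => rE; apply/exT; eexists; exact: rE.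
move=> b; rewrite diffE => ib; have /exT[s <-] : tensorr E (free_eval (syzygy i.+1 M)) b = 0.
  by apply: (tz _ _ _ _ (SE i)); rewrite ib raddf0.
have [_ _ su2] := SE i.+2; have [r <-] := tensorr_surj E su2 s.
by exists r; rewrite diffE.
Qed.

Lemma Tor1_trivial E M : trivial_module (Tor 1 E M) <-> tor1_zero E M.
Proof. exact: Tor_trivial_syzygy 0%N E M. Qed.

Lemma Tor_trivial i E M :
  trivial_module (Tor i.+1 E M) <-> tor1_zero (syzygy i E) M.
Proof. exact: iff_trans (Tor_trivial_syzygy i E M) (tor1_zero_syzygy i E M). Qed.

Lemma Tor_shift i E (A B C : lmodType R) (f : {linear A -> B})
    (g : {linear B -> C}) :
  short_exact f g -> (forall j, trivial_module (Tor j.+1 E B)) ->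
  trivial_module (Tor i.+2 E C) <-> trivial_module (Tor i.+1 E A).
Proof.
move=> fg EB; rewrite !Tor_trivial.
apply: (tor1_zero_shift (short_exact_free (syzygy i E)) fg).
  exact/Tor_trivial.
by have /Tor_trivial := EB i.+1.
Qed.

Lemma Tor_flat i E P : flat P -> trivial_module (Tor i.+1 E P).
Proof. by move=> fP; apply/Tor_trivial/flat_tor1_zero. Qed.

Lemma Tor_ext i E (A B C : lmodType R) (f : {linear A -> B})
    (g : {linear B -> C}) : short_exact f g ->
  trivial_module (Tor i.+1 E A) -> trivial_module (Tor i.+1 E C) ->
  trivial_module (Tor i.+1 E B).
Proof. by rewrite !Tor_trivial => fg; exact: (tor1_zero_ext fg). Qed.

(** The piece [Tor (i.+2) E3 -> Tor (i.+1) E1 -> Tor (i.+1) E2] of the long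
    exact sequence in the first variable. *)
Lemma Tor_ext_l i (E1 E2 E3 : lmodType R^c) (f : {linear E1 -> E2})
    (g : {linear E2 -> E3}) M : short_exact f g ->
  trivial_module (Tor i.+1 E2 M) -> trivial_module (Tor i.+2 E3 M) ->
  trivial_module (Tor i.+1 E1 M).
Proof.
rewrite !Tor_trivial_syzygy => fg E2M E3M.
have kp := short_exact_free (syzygy i M).
apply: (tor1_zero_of_r kp); first exact/flat_tor1_zero/free_flat.
move=> s t /(congr1 (tensorl f _)); rewrite !tensor_swap => /(E2M _ _ _ _ kp).
exact: (tor1_zero_inj_l E3M fg).
Qed.

End Tor.

(** * Enough injectives *)

Section DivisibleHull.
Variable V : zmodType.

Definition int_lift : {linear free int V -> zmodule V} :=
  free_lift (fun x : V => x : zmodule V).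

(** The relations of [V], as combinations of basis elements with integral
    coefficients, inside the rational vector space on the set [V]. *)
Definition hull_pred : pred (free rat V) := fun u =>
  `[< exists v : free int V,
        (forall x, val u x = (val v x : int)%:~R :> rat) /\ int_lift v = 0 >].

Lemma hull_pred_zmod_closed : zmod_closed hull_pred.
Proof.
split=> [|u u' /asboolP[v [uv v0]] /asboolP[v' [uv' v0']]]; apply/asboolP.
  by exists 0; split=> [x|]; rewrite ?linear0.
exists (v - v'); split=> [x|]; last by rewrite linearB v0 v0' subrr.
rewrite -[LHS]/((val u x : rat) - val u' x) uv uv'.
by rewrite -[val (v - v') x]/((val v x : int) - val v' x) intrB.
Qed.
HB.instance Definition _ :=
  GRing.isZmodClosed.Build (free rat V) hull_pred hull_pred_zmod_closed.

Definition hull : zmodType :=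
  Quotient.quot (GRing.ZmodClosed.clone (free rat V) hull_pred _).

(** Present [V] as the free abelian group on its elements modulo relations; the
    rational vector space on the same basis modulo the same relations is
    divisible and contains [V], since an integral combination that becomes a
    relation was one already. *)
Lemma divisible_embedding : exists (D : zmodType) (i : {additive V -> D}),
  injective i /\ forall (d : D) n, (0 < n)%N -> exists e, e *+ n = d.
Proof.
pose p : {additive free rat V -> hull} := (\pi_hull)%qT.
have p0 u : p u = 0 <-> hull_pred u.
  rewrite -(raddf0 p); split=> [/eqP|hu].
    by rewrite /p /= -Quotient.idealrBE subr0.
  by apply/eqP; rewrite /p /= -Quotient.idealrBE subr0.
have iB : zmod_morphism (fun x => p (free_basis rat x)).
  move=> x y; apply/eqP; rewrite -subr_eq0 -!raddfB; apply/eqP/p0/asboolP.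
  pose b (z : V) := free_basis int z.
  exists (b (x - y) - (b x - b y)); split.
    move=> z; rewrite -[val (b _ - _) z]/(val (b (x - y)) z - (val (b x) z - val (b y) z) : int).
    rewrite !intrB -[LHS]/(val (free_basis rat (x - y)) z -
      (val (free_basis rat x) z - val (free_basis rat y) z) : rat) /=.
    by do 3!case: ifP => _.
  rewrite /int_lift !linearB /= !free_lift_basis.
  have zero2 (x' y' : V) : x' - y' + (- x' - - y') = 0.
    by rewrite -opprD subrr.
  exact: zero2.
pose im := GRing.isZmodMorphism.Build V hull _ iB.
pose i : {additive V -> hull} := HB.pack (fun x => p (free_basis rat x)) im.
exists hull, i; split=> [|d n n0].
  apply: raddf_inj => x /p0/asboolP[v [xv v0]].
  suff vx : v = free_basis int x by move: v0; rewrite vx /int_lift /= free_lift_basis.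
  apply: val_inj; apply/funext => z; apply: (@intr_inj rat).
  by rewrite -xv /=; case: ifP.
rewrite -[d]reprK; pose u : free rat V := repr d.
exists (p (((n%:R)^-1 : rat) *: u)); rewrite -raddfMn -scaler_nat scalerA.
by rewrite mulfV ?scale1r // Num.Theory.pnatr_eq0 -lt0n.
Qed.

End DivisibleHull.

(** Zorn's lemma on the graphs of partial extensions of [g].  A maximal one is
    total: to extend it to [b], it suffices to find [d] with [d *~ n] equal to
    its value at [b *~ n] whenever [b *~ n] is in the domain.  These [n] are the
    multiples of the smallest positive one [m], if any, and [d] is then an
    [m]-th part of the value at [b *+ m]. *)
Lemma divisible_extension (D A B : zmodType) (f : {additive A -> B})
    (g : {additive A -> D}) :
  (forall (d : D) n, (0 < n)%N -> exists e, e *+ n = d) -> injective f ->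
  exists h : {additive B -> D}, forall a, h (f a) = g a.
Proof.
move=> divD inf.
(* A partial extension, as a subgroup of [B * D] that is the graph of a function. *)
pose partial (G : set (B * D)) := [/\ forall a, G (f a, g a),
  forall x y, G x -> G y -> G (x - y) & forall d, G (0, d) -> d = 0].
(* The empty set is admitted because it is the union of the empty chain. *)
pose P (G : set (B * D)) := G = classical_sets.set0 \/ partial G.
have [|G [PG Gmax]] := @Zorn_bigcup _ P.
  move=> F FP Ftot.
  have [[G0 FG0 [[b0 d0] Gbd]]|noF] := pselect (exists2 G, F G & exists x, G x).
  have partF G : F G -> (exists x, G x) -> partial G.
    by move=> /FP[-> [? []]|].
  have [f0 _ _] := partF _ FG0 (ex_intro _ _ Gbd).
  right; split=> [a|x y [X FX Xx] [Y FY Yy]|d [X FX Xd]].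
  - by exists G0.
  - have [_ XB _] := partF X FX (ex_intro _ _ Xx).
    have [_ YB _] := partF Y FY (ex_intro _ _ Yy).
    have [XY|YX] := Ftot _ _ FX FY.
      by exists Y => //; apply: YB => //; exact: XY.
    by exists X => //; apply: XB => //; exact: YX.
  - by have [_ _] := partF X FX (ex_intro _ _ Xd); apply.
  left; apply/seteqP; split=> // x [X FX Xx]; apply: noF.
  by exists X => //; exists x.
(* The maximal element is not empty: the graph of [g] over [f] is larger. *)
have {PG} pG : partial G.
  case: PG => // G0; pose G1 := [set x : B * D | exists a, x = (f a, g a)]%classic.
  have GG1 : (G `<` G1)%classic.
    rewrite G0; split=> // sub; have := sub (f 0, g 0); apply.
    by exists 0.
  exfalso; apply: (Gmax G1 GG1); right; split=> [a|_ _ [a ->] [b ->]|d [a [fa ->]]].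
  - by exists a.
  - by exists (a - b); rewrite !raddfB.
  - by rewrite -(raddf0 g); congr (g _); apply: inf; rewrite raddf0.
have [Gf GB Gfun] := pG.
have G0 : G 0 by rewrite -(subrr (f 0, g 0)); exact: GB.
have GN x : G x -> G (- x) by rewrite -sub0r; exact: GB.
have GD x y : G x -> G y -> G (x + y).
  by move=> Gx Gy; rewrite -[y]opprK; apply: GB => //; exact: GN.
have Gn x n : G x -> G (x *+ n).
  by move=> Gx; elim: n => [|n IHn]; rewrite ?mulr0n // mulrS; exact: GD.
have Gz x (n : int) : G x -> G (x *~ n).
  by move=> Gx; case: n => n; rewrite /intmul; [|apply: GN]; exact: Gn.
have GM b d (n : int) : G (b, d) -> G (b *~ n, d *~ n).
  move=> /(Gz _ n); congr G; rewrite [LHS]surjective_pairing.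
  by rewrite (raddfMz fst) (raddfMz snd).
have Gtot b : exists d, G (b, d).
  have [//|nb] := pselect (exists d, G (b, d)).
  have [d dP] : exists d, forall (n : int) e, G (b *~ n, e) -> e = d *~ n.
    have [[n [n0 [e Ge]]]|no] := pselect (exists n, (0 < n)%N /\ exists e, G (b *+ n, e)).
      have exn : exists n, (0 < n)%N && `[< exists e, G (b *+ n, e) >].
        by exists n; rewrite n0; apply/asboolP; exists e.
      (* [m] generates the ideal of the [n] with [b *~ n] in the domain. *)
      case: (ex_minnP exn) => m /andP[m0 /asboolP[c Gc]] mmin.
      have [d dE] := divD c m m0; exists d => k a Ga.
      have mz : (m : int) != 0 by rewrite -lt0n in m0 *; case: m m0 {dE Gc mmin}.
      have := divz_eq k m; set q := (k %/ m)%Z; set r := (k %% m)%Z => kE.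
      have r0 : 0 <= r by exact: modz_ge0.
      have rm : r < m by apply: ltz_pmod.
      have Gr : G (b *~ r, a - c *~ q).
        have := GB _ _ Ga (GM _ _ q Gc); congr (G (_, _)).
        by rewrite /= kE mulrzDr pmulrn -mulrzA mulrC addrAC subrr add0r.
      case: r r0 rm kE Gr => // r _ rm kE Gr.
      have [r0|r0] := posnP r; last first.
        have := mmin r; rewrite r0 /= => /(_ (asboolT (ex_intro _ _ Gr))).
        by rewrite leqNgt -ltz_nat rm.
      move: Gr; rewrite r0 mulr0z => /Gfun/eqP; rewrite subr_eq0 => /eqP ->.
      by rewrite kE r0 addr0 -dE pmulrn -mulrzA mulrC.
    exists 0 => n e Ge; rewrite mul0rz.
    case: n Ge => [[|n]|n] Ge.
    - exact: Gfun.
    - by case: no; exists n.+1; split=> //; exists e.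
    - case: no; exists n.+1; split=> //; exists (- e).
      by have := GN _ Ge; rewrite -[- _]/(- _, - _) opprK.
  (* The graph extended by [b |-> d] contradicts maximality. *)
  pose G' := [set x : B * D | exists n y, G y /\ x = y + (b *~ n, d *~ n)]%classic.
  exfalso; apply: (Gmax G').
    split=> [x Gx|sub]; first by exists 0, x; rewrite !mulr0z addr0.
    apply: nb; exists d; apply: sub; exists 1, 0; split=> //.
    by rewrite !mulr1z add0r.
  right; split=> [a|_ _ [n [x [Gx ->]]] [m [y [Gy ->]]]|c [n [[x y] [Gx [x0 ->]]]]].
  - by exists 0, (f a, g a); rewrite !mulr0z addr0.
  - exists (n - m), (x - y); split; first exact: GB.
    by rewrite opprD addrACA; congr (_ + _); rewrite !mulrzBr.
  - have : G (b *~ (- n), y).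
      by rewrite mulrNz; move: Gx; congr (G (_, _)); apply/eqP; rewrite -addr_eq0 -x0.
    by move/dP ->; rewrite mulrNz addNr.
have [h hE] : exists h : B -> D, forall b, G (b, h b).
  by exists (fun b => sval (cid (Gtot b))) => b; case: cid.
have huniq b d d' : G (b, d) -> G (b, d') -> d = d'.
  move=> Gd Gd'; apply/eqP; rewrite -subr_eq0; apply/eqP/Gfun.
  by rewrite -(subrr b); exact: GB Gd Gd'.
have hB : zmod_morphism h.
  by move=> x y; apply: huniq (hE _) _; exact: GB (hE x) (hE y).
pose hm := GRing.isZmodMorphism.Build B D h hB.
pose h' : {additive B -> D} := HB.pack h hm.
by exists h' => a; apply: huniq (hE _) (Gf a).
Qed.

Section Coinduced.
Variables (S : pzRingType) (D : zmodType).

(** Additivity as a predicate on functions, so that additive maps inherit the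
    pointwise group structure. *)
Definition coind_pred : pred (S -> D) := fun u => `[< zmod_morphism u >].

Lemma coind_pred_zmod_closed : zmod_closed coind_pred.
Proof.
split=> [|u v /asboolP uB /asboolP vB]; apply/asboolP => x y.
  by rewrite -![(0 : S -> D) _]/(0 : D) subr0.
by rewrite -![(u - v) _]/(u _ - v _) uB vB !opprD !opprK addrACA.
Qed.
HB.instance Definition _ :=
  GRing.isZmodClosed.Build (S -> D) coind_pred coind_pred_zmod_closed.

Definition coind : Type := {u : S -> D | coind_pred u}.
HB.instance Definition _ := SubType.on coind.
HB.instance Definition _ := [Choice of coind by <:].
HB.instance Definition _ := [SubChoice_isSubZmodule of coind by <:].

Lemma coindB (u : coind) : zmod_morphism (val u).
Proof. exact/asboolP/(valP u). Qed.

Lemma coind_scale_subproof (a : S) (u : coind) :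
  coind_pred (fun s => val u (s * a)).
Proof. by apply/asboolP => x y; rewrite mulrBl coindB. Qed.

Definition coind_scale (a : S) (u : coind) : coind :=
  exist (fun v => coind_pred v) _ (coind_scale_subproof a u).

Lemma coind_scaleA a b u : coind_scale a (coind_scale b u) = coind_scale (a * b) u.
Proof. by apply: val_inj; apply/funext => s /=; rewrite mulrA. Qed.
Lemma coind_scale1 : left_id 1 coind_scale.
Proof. by move=> u; apply: val_inj; apply/funext => s /=; rewrite mulr1. Qed.
Lemma coind_scaleDr : right_distributive coind_scale +%R.
Proof. by move=> a u v; apply: val_inj; apply/funext. Qed.
Lemma coind_scaleDl u : {morph coind_scale^~ u : a b / a + b}.
Proof.
move=> a b; apply: val_inj; apply/funext => s /=; rewrite mulrDr.
have u0 : val u 0 = 0 by have := coindB u 0 0; rewrite !subrr.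
have uN x : val u (- x) = - val u x by have := coindB u 0 x; rewrite u0 !sub0r.
have uD x y : val u (x + y) = val u x + val u y.
  by have := coindB u x (- y); rewrite uN !opprK.
exact: uD.
Qed.
HB.instance Definition _ := GRing.Zmodule_isLmodule.Build S coind
  coind_scaleA coind_scale1 coind_scaleDr coind_scaleDl.

(** The adjunction between restriction to abelian groups and coinduction. *)
Lemma coind_linear_exists (B : lmodType S) (h : {additive B -> D}) :
  exists H : {linear B -> coind}, forall b s, val (H b) s = h (s *: b).
Proof.
have hp b : coind_pred (fun s => h (s *: b)).
  by apply/asboolP => x y; rewrite scalerBl raddfB.
have [|H HE] := @linear_bundle S B coind
    (fun b => exist (fun v => coind_pred v) _ (hp b)).
  move=> a x y; apply: val_inj; apply/funext => s.
  rewrite -[RHS]/(h ((s * a) *: x) + h (s *: y)) /=.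
  by rewrite scalerDr raddfD scalerA.
by exists H => b s; rewrite HE.
Qed.

(** By adjunction, the extension of linear maps to [coind S D] reduces to the
    extension of their values at [1], which are additive maps to [D]. *)
Lemma coind_injective :
  (forall (d : D) n, (0 < n)%N -> exists e, e *+ n = d) ->
  injective_module (coind : lmodType S).
Proof.
move=> divD A B f g inf.
have g1B : zmod_morphism (fun a => val (g a) 1) by move=> x y; rewrite linearB.
pose gm := GRing.isZmodMorphism.Build A D _ g1B.
pose g1 : {additive A -> D} := HB.pack (fun a => val (g a) 1) gm.
have [h hE] := divisible_extension g1 divD inf.
have [H HE] := coind_linear_exists h.
exists H => a; apply: val_inj; apply/funext => s.
rewrite HE -linearZ_LR hE /= linearZ_LR.
by rewrite -[LHS]/(val (g a) (1 * s)) mul1r.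
Qed.

End Coinduced.

Lemma enough_injectives (S : pzRingType) (E : lmodType S) :
  exists (I : lmodType S) (i : {linear E -> I}),
    injective_module I /\ injective i.
Proof.
have [D [i [ii divD]]] := divisible_embedding E.
have [H HE] := coind_linear_exists i.
exists (coind S D : lmodType S), H; split; first exact: coind_injective.
move=> x y /(congr1 (fun u => val u 1)); rewrite !HE !scale1r; exact: ii.
Qed.

Section FlatInjectives.
Variable R : pzRingType.

(** [Q] has flat dimension at most one, so [Tor 2 E Q = 0] for every [E].
    Embedding [E] in an injective [I] then places [Tor 1 E Q] between
    [Tor 2 (I / E) Q = 0] and [Tor 1 I Q = 0]. *)
Lemma flat_of_tor_injective (A B Q : lmodType R)
    (f : {linear A -> B}) (g : {linear B -> Q}) :
  short_exact f g -> flat A -> flat B ->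
  (forall I : lmodType R^c, injective_module I -> trivial_module (Tor 1 I Q)) ->
  flat Q.
Proof.
move=> fg fA fB IQ; apply: tor1_zero_flat => E.
have [I [i [injI ii]]] := enough_injectives E.
apply/Tor1_trivial/(Tor_ext_l (coker_short_exact ii)); first exact: IQ.
by apply/(Tor_shift _ fg) => [j|]; exact: Tor_flat.
Qed.

End FlatInjectives.

(** * Gorenstein flat modules over an arbitrary ring *)

Section GorensteinFlat.
Variable R : pzRingType.

(** If [d] and [m] are consecutive maps of a complex that tensoring with [I]
    keeps exact, then the image [L] of [m] stays embedded. *)
Lemma tensorr_factor_inj (I : lmodType R^c) (A B L C : lmodType R)
    (d : {linear A -> B}) (p : {linear B -> L}) (v : {linear L -> C})
    (m : {linear B -> C}) :
  surjective p -> (forall x, v (p x) = m x) -> (forall x, p (d x) = 0) ->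
  exact (tensorr I d) (tensorr I m) -> injective (tensorr I v).
Proof.
move=> sp pE pd ex; apply: raddf_inj => t; have [t' <-] := tensorr_surj I sp t.
rewrite /= (tensorr_comp pE) => /ex[s <-].
rewrite (@tensorr_comp R I _ _ _ d p \0) //.
by apply: tensor_map_eq0 => x y; rewrite /= pure_tensor0r.
Qed.

(** Exactness depends only on the image of the first map and on the kernel of
    the second, so it survives composition with a surjection and an injection. *)
Lemma exact_splice (A K B L C : zmodType) (a : A -> B)
    (k : K -> B) (b : B -> L) (p : A -> K) (c : B -> C) (j : L -> C) :
  exact k b -> surjective p -> injective j -> j 0 = 0 ->
  (forall x, k (p x) = a x) -> (forall x, j (b x) = c x) -> exact a c.
Proof.
move=> kb sp ij j0 aE cE x; rewrite -cE; split=> [jb|[y <-]].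
  have /kb[z <-] : b x = 0 by apply: ij; rewrite jb j0.
  by have [y <-] := sp z; exists y.
by rewrite -aE (kb _).2 //; exists (p y).
Qed.

Lemma isomorphic_refl (M : lmodType R) : isomorphic M M.
Proof. by exists idfun; exists idfun. Qed.

Lemma isomorphic_trans (M N P : lmodType R) :
  isomorphic M N -> isomorphic N P -> isomorphic M P.
Proof. by move=> [f fb] [g gb]; exists (g \o f); exact: bij_comp. Qed.

Lemma gorenstein_flat_iso (M N : lmodType R) :
  isomorphic M N -> gorenstein_flat N -> gorenstein_flat M.
Proof.
move=> MN [X [Y [d [m [e [fl ex iso ten]]]]]]; exists X, Y, d, m, e; split=> //.
exact: isomorphic_trans iso.
Qed.

Lemma linear_bij_isomorphic (M N : lmodType R) (f : {linear M -> N}) :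
  injective f -> surjective f -> isomorphic M N.
Proof.
move=> inf sf; exists f.
have [s sK] : exists s : N -> M, forall y, f (s y) = y.
  by exists (fun y => sval (cid (sf y))) => y; case: cid.
by exists s => // x; apply: inf; rewrite sK.
Qed.

Lemma isomorphic_bij (M N : lmodType R) : isomorphic M N ->
  exists f : {linear M -> N}, injective f /\ surjective f.
Proof.
move=> [f [g gK fK]]; exists f; split; first exact: can_inj gK.
by move=> y; exists (g y).
Qed.

(** Shift the complete resolution one step to the right: the image of
    [Y 0 -> Y 1] is again Gorenstein flat. *)
Lemma gorenstein_flat_coker (M : lmodType R) : gorenstein_flat M ->
  exists (F N : lmodType R) (f : {linear M -> F}) (g : {linear F -> N}),
    [/\ short_exact f g, flat F & gorenstein_flat N].
Proof.
move=> [X [Y [d [m [e [[flX flY] [exd exdm exme exe] iso ten]]]]]].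
have [h [ih sh]] := isomorphic_bij iso.
have [p [v [sp iv pE]]] := limage_factor m.
have [q [w [sq iw qE]]] := limage_factor (e 0%N).
exists (Y 0%N), (limage (e 0%N)), (v \o h), q; split=> //.
- split=> // [x y /= /iv/ih //|b].
  have -> : q b = 0 <-> e 0%N b = 0.
    by rewrite -qE; split=> [->|eb]; [rewrite linear0|apply: iw; rewrite eb linear0].
  rewrite exme; split=> [[a <-]|[a <-]] /=.
    by have [x hx] := sh (p a); exists x; rewrite hx.
  by have [x <-] := sp (h a); exists x.
- pose X' n := if n is k.+1 then X k else Y 0%N.
  pose d' n : {linear X' n.+1 -> X' n} :=
    if n is k.+1 return {linear X' n.+1 -> X' n} then d k else m.
  exists X', (fun n => Y n.+1), d', (e 0%N), (fun n => e n.+1); split=> //.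
  + by split=> // -[|n]; [exact: flY|exact: flX].
  + by split=> [[|n]|||n]; [exact: exdm|exact: exd|exact: exme|exact: exe|exact: (exe n.+1)].
  + exact: isomorphic_refl.
  + move=> I /ten[t1 t2 t3 t4].
    by split=> [[|n]|||n]; [exact: t2|exact: t1|exact: t3|exact: t4|exact: (t4 n.+1)].
Qed.

(** Shift the complete resolution one step to the left.  The last clause is the
    vanishing of [Tor 1 I M], in the form available before Tor is known to be
    computed by flat resolutions. *)
Lemma gorenstein_flat_ker (M : lmodType R) : gorenstein_flat M ->
  exists (N F : lmodType R) (f : {linear N -> F}) (g : {linear F -> M}),
    [/\ short_exact f g, flat F, gorenstein_flat N
      & forall I : lmodType R^c, injective_module I -> injective (tensorr I f)].
Proof.
move=> [X [Y [d [m [e [[flX flY] [exd exdm exme exe] iso ten]]]]]].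
have [h [ih sh]] := isomorphic_bij iso.
have [p [v [sp iv pE]]] := limage_factor m.
have [q [w [sq iw qE]]] := limage_factor (d 0%N).
have [|g gE] := @linear_factor_inj R _ _ _ h p ih; first by move=> x; exact: sh.
have qd x : q (d 1%N x) = 0.
  by apply: iw; rewrite qE linear0; apply/exd; exists x.
exists (limage (d 0%N)), (X 0%N), w, g; split=> //.
- split=> // [b|y].
  + have -> : g b = 0 <-> m b = 0.
      rewrite -pE -gE; split=> [->|gb]; first by rewrite !linear0.
      by apply: ih; apply: iv; rewrite gb !linear0.
    rewrite exdm; split=> [[a <-]|[a <-]]; first by exists (q a).
    by have [x <-] := sq a; exists x.
  + have [x px] := sp (h y); exists x; apply: ih.
    by rewrite gE.
- pose Y' n := if n is k.+1 then Y k else X 0%N.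
  pose e' n : {linear Y' n -> Y' n.+1} :=
    if n is k.+1 return {linear Y' n -> Y' n.+1} then e k else m.
  exists (fun n => X n.+1), Y', (fun n => d n.+1), (d 0%N), e'; split=> //.
  + by split=> // -[|n]; [exact: flX|exact: flY].
  + by split=> [n|||[|n]]; [exact: (exd n.+1)|exact: exd|exact: exdm|exact: exme|exact: exe].
  + exact: isomorphic_refl.
  + move=> I /ten[t1 t2 t3 t4].
    by split=> [n|||[|n]]; [exact: (t1 n.+1)|exact: t1|exact: t2|exact: t3|exact: t4].
- by move=> I /ten[t1 _ _ _]; apply: tensorr_factor_inj sq qE qd (t1 0%N).
Qed.

Lemma gorenstein_flat_Tor (M : lmodType R) (I : lmodType R^c) i :
  gorenstein_flat M -> injective_module I -> trivial_module (Tor i.+1 I M).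
Proof.
move=> + injI; elim: i M => [|i IHi] M /gorenstein_flat_ker[N [F [f [g [fg fF gN fI]]]]].
  apply/Tor1_trivial.
  by apply: (tor1_zero_of_r fg (flat_tor1_zero fF)); exact: fI.
by apply/(Tor_shift i fg) => [j|]; [exact: Tor_flat|exact: IHi].
Qed.

(** The free resolution of [A], followed by [F] and the right half of a complete
    resolution of [G], is a complete resolution with [A] as the image of its
    middle map.  After tensoring with an injective [I], exactness on the left
    is [Tor j.+1 I A = 0], obtained by shifting from [G], and exactness at the
    joints uses that [A -> F] and [G -> Y 0] stay injective. *)
Lemma gorenstein_flat_of_coker (A F G : lmodType R) (f : {linear A -> F})
    (g : {linear F -> G}) :
  short_exact f g -> flat F -> gorenstein_flat G -> gorenstein_flat A.
Proof.
move=> fg flF gG; have [inf exf sg] := fg.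
have TorA j (I : lmodType R^c) : injective_module I -> trivial_module (Tor j.+1 I A).
  move=> injI; apply/(Tor_shift j fg) => [k|]; first exact: Tor_flat.
  exact: gorenstein_flat_Tor.
have [X [Y [d [m [e [[_ flY] [_ exdm exme exe] iso ten]]]]]] := gG.
have [h [ih sh]] := isomorphic_bij iso.
have [p [v [sp iv pE]]] := limage_factor m.
have [|k kE] := @linear_factor_inj R _ _ _ h p ih; first by move=> x; exact: sh.
pose u : {linear G -> Y 0%N} := v \o h.
have iu : injective u by move=> x y /iv/ih.
have sk : surjective k.
  by move=> y; have [x px] := sp (h y); exists x; apply: ih; rewrite kE.
have ukE x : u (k x) = m x by rewrite /u /= kE pE.
have Iu I : injective_module I -> injective (tensorr I u).
  move=> /ten[_ t2 _ _]; apply: (tensorr_factor_inj sk ukE _ t2) => x.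
  by apply: iu; rewrite ukE linear0; apply/exdm; exists x.
clearbody u; pose Y' n := if n is k.+1 then Y k else F.
pose e' n : {linear Y' n -> Y' n.+1} :=
  if n is k.+1 return {linear Y' n -> Y' n.+1} then e k else u \o g.
pose m' : {linear res_obj A 0 -> F} := f \o free_eval A.
have SE j : short_exact (res_incl A j) (free_eval (syzygy j A)).
  exact: short_exact_free.
have [_ exA sA] := SE 0%N; have [_ _ sA1] := SE 1%N.
exists (res_obj A), Y', (res_diff A), m', e'; split.
- by split=> [n|[|n]]; [exact: free_flat|exact: flF|exact: flY].
- split=> [n|b|b|[|n]]; last exact: exe.
  + have [_ ex _] := SE n.+1; have [_ _ su] := SE n.+2; have [inj _ _] := SE n.
    exact: (exact_splice ex su inj (linear0 _)).
  + exact: (exact_splice exA sA1 inf (linear0 _)).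
  + exact: (exact_splice exf sA iu (linear0 _)).
  + move=> b; rewrite exme; split=> [[x <-]|[x <-]].
      by have [z gz] := sg (k x); exists z; rewrite /= gz ukE.
    by have [z kz] := sk (g x); exists z; rewrite -ukE kz.
- have [p' [v' [sp' iv' pE']]] := limage_factor m'.
  have [|q qE] := @linear_factor_surj R _ _ _ (free_eval A) p' sA.
    by move=> x x0; apply: iv'; rewrite pE' /= x0 !linear0.
  apply: (@linear_bij_isomorphic _ _ q) => [x y|y].
    have [x' <-] := sA x; have [y' <-] := sA y; rewrite !qE => /(congr1 v').
    by rewrite !pE' => /inf.
  by have [x <-] := sp' y; exists (free_eval A x); rewrite qE.
- move=> I injI; have [_ _ t3 t4] := ten I injI; split=> [n|||[|n]]; last exact: t4.
  + have [_ ex su] := SE n.+1; have [_ _ su2] := SE n.+2.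
    have inj := (Tor_trivial_syzygy n I A).1 (TorA n I injI) _ _ _ _ (SE n).
    apply: (exact_splice (tensorr_exact I ex su) (tensorr_surj I su2) inj (raddf0 _));
      exact: tensorr_comp.
  + have inj := (Tor1_trivial I G).1 (gorenstein_flat_Tor (i := 0%N) gG injI) _ _ _ _ fg.
    apply: (exact_splice (tensorr_exact I exA sA) (tensorr_surj I sA1) inj (raddf0 _));
      exact: tensorr_comp.
  + apply: (exact_splice (tensorr_exact I exf sg) (tensorr_surj I sA) (Iu I injI) (raddf0 _));
      exact: tensorr_comp.
  + move=> b; rewrite (t3 b); split=> [[x <-]|[x <-]].
      have [z gz] := tensorr_surj I sg (tensorr I k x); exists z.
      by rewrite -(@tensorr_comp R I _ _ _ g u) // gz (tensorr_comp ukE).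
    have [z kz] := tensorr_surj I sk (tensorr I g x); exists z.
    by rewrite -(tensorr_comp ukE) kz; apply: tensorr_comp.
Qed.

Lemma tensor_trivial_r (E : lmodType R^c) (N : lmodType R) :
  trivial_module N -> trivial_module (tensor E N).
Proof.
move=> N0; elim/tensor_ind => [//|x y|s t -> ->]; last exact: subrr.
by rewrite (N0 y) pure_tensor0r.
Qed.

Lemma trivial_gorenstein_flat (Z : lmodType R) :
  trivial_module Z -> gorenstein_flat Z.
Proof.
move=> Z0; have flZ : flat Z.
  apply/flatP => X Y h _ s t _; rewrite [s](tensor_trivial_r Z0).
  by rewrite [t](tensor_trivial_r Z0).
have ex (A B C : zmodType) (f : {additive A -> B}) (g : {additive B -> C}) :
    trivial_module B -> trivial_module C -> exact f g.
  move=> B0 C0 b; split=> _; last exact: C0.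
  by exists 0; rewrite raddf0 (B0 b).
have exZ (f g : {linear Z -> Z}) : exact f g by exact: ex.
have exT (I : lmodType R^c) (f g : {linear Z -> Z}) :
  exact (tensorr I f) (tensorr I g) by apply: ex; exact: tensor_trivial_r.
exists (fun=> Z), (fun=> Z), (fun=> idfun), idfun, (fun=> idfun); split.
- by split.
- by split=> [n|||n]; exact: (exZ idfun idfun).
- have [p [v [sp iv vp]]] := limage_factor (idfun : {linear Z -> Z}).
  apply: (@linear_bij_isomorphic _ _ p) sp => x y /(congr1 v).
  by rewrite !vp.
- by move=> I _; split=> [n|||n]; exact: (exT I idfun idfun).
Qed.

(** A flat module embeds in itself with zero cokernel. *)
Lemma flat_gorenstein_flat (P : lmodType R) : flat P -> gorenstein_flat P.
Proof.
move=> flP; pose Z : lmodType R := lker (idfun : {linear P -> P}).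
have Z0 : trivial_module Z.
  by move=> z; apply: val_inj; apply/eqP; exact: (valP z).
have PZ : short_exact (idfun : {linear P -> P}) (\0 : {linear P -> Z}).
  split=> // [x|z]; first by split=> [_|_]; [exists x|].
  by exists 0; rewrite (Z0 z).
exact: gorenstein_flat_of_coker PZ flP (trivial_gorenstein_flat Z0).
Qed.

End GorensteinFlat.

(** * Gorenstein flat dimension over a GF-closed ring *)

Section GorensteinFlatDimension.
Variable R : pzRingType.
Context (hR : GF_closed R).

(** In the notation of the proof, [D] is an extension of [B] by [C'] and, by the
    other projection, of [F] by [A].  It embeds in a flat [F'] with Gorenstein
    flat cokernel [G], so [F' / A] is an extension of [G] by [F]. *)
Lemma gorenstein_flat_kernel (A B C : lmodType R)
    (f : {linear A -> B}) (g : {linear B -> C}) :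
  short_exact f g -> gorenstein_flat B -> gorenstein_flat C ->
  gorenstein_flat A.
Proof.
move=> fg gB gC.
have [C' [F [c [p [cp flF gC' _]]]]] := gorenstein_flat_ker gC.
have [D [i [b [j [a [ib ja _ _]]]]]] := pullback cp fg.
have gD := hR ib gC' gB.
have [F' [G [u [v [uv flF' gG]]]]] := gorenstein_flat_coker gD.
have [iu _ _] := uv; have [ij _ _] := ja.
have iuj : injective (u \o j) by move=> x y /= /iu/ij.
have [w [r wr]] := coker_chain (h := u \o j) ja uv (fun=> erefl) (coker_short_exact iuj).
have gQ := hR wr (flat_gorenstein_flat flF) gG.
exact: gorenstein_flat_of_coker (coker_short_exact iuj) flF' gQ.
Qed.

(** The pushout [D] is an extension of [H] by [B] and of [M] by [F].  It embeds in
    a flat [F'] with Gorenstein flat cokernel [G], and [M] embeds in [F' / F]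
    with the same cokernel.  As [Tor 1 I] vanishes on [M] and [G], it vanishes on
    [F' / F], which is therefore flat. *)
Lemma gorenstein_flat_quotient (A B M : lmodType R)
    (f : {linear A -> B}) (g : {linear B -> M}) :
  short_exact f g -> gorenstein_flat A -> gorenstein_flat B ->
  (forall I : lmodType R^c, injective_module I -> trivial_module (Tor 1 I M)) ->
  gorenstein_flat M.
Proof.
move=> fg gA gB TM.
have [F [H [u [v [uv flF gH]]]]] := gorenstein_flat_coker gA.
have [D [b [p [a [q [bp aq]]]]]] := pushout fg uv.
have gD := hR bp gB gH.
have [F' [G [s [t [st flF' gG]]]]] := gorenstein_flat_coker gD.
have [is_ _ _] := st; have [ia _ _] := aq.
have isa : injective (s \o a) by move=> x y /= /is_/ia.
have saq := coker_short_exact isa.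
have [w [r wr]] := coker_chain (h := s \o a) aq st (fun=> erefl) saq.
have flQ : flat (coker (s \o a)).
  apply: (flat_of_tor_injective saq flF flF') => I injI.
  by apply: (Tor_ext wr); [exact: TM|exact: gorenstein_flat_Tor].
exact: gorenstein_flat_of_coker wr flQ gG.
Qed.

(** The inductive form of [Gfd_le], better suited to diagram arguments than an
    indexed resolution. *)
Fixpoint gf_resolved (n : nat) (M : lmodType R) : Prop :=
  if n is k.+1 then
    exists (L G : lmodType R) (f : {linear L -> G}) (g : {linear G -> M}),
      [/\ short_exact f g, gorenstein_flat G & gf_resolved k L]
  else gorenstein_flat M.

Lemma free_projective (X : choiceType) (P N : lmodType R) (q : {linear P -> N})
    (h : {linear free R X -> N}) : surjective q ->
  exists l : {linear free R X -> P}, forall x, q (l x) = h x.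
Proof.
move=> sq; have [s sK] : exists s : X -> P, forall x, q (s x) = h (free_basis R x).
  by exists (fun x => sval (cid (sq (h (free_basis R x))))) => x; case: cid.
exists (free_lift s); apply: (free_linear_ext (f := q \o free_lift s)) => x /=.
by rewrite free_lift_basis.
Qed.

(** The horseshoe lemma with a free cover on the right, where only surjections
    onto the outer terms are prescribed: [T] is [H * free R X], and it maps to
    [P] by [i \o p] and a lifting of [p'] through [q]. *)
Lemma horseshoe (L' H L P G' G : lmodType R) (X : choiceType)
    (k : {linear L' -> H}) (p : {linear H -> L})
    (i : {linear L -> P}) (q : {linear P -> G})
    (k' : {linear G' -> free R X}) (p' : {linear free R X -> G}) :
  short_exact k p -> short_exact i q -> short_exact k' p' ->
  exists (T K : lmodType R) (h : {linear H -> T}) (x : {linear T -> free R X})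
    (c : {linear K -> T}) (s : {linear T -> P})
    (u : {linear L' -> K}) (v : {linear K -> G'}),
    [/\ short_exact h x, short_exact c s & short_exact u v].
Proof.
move=> kp iq kp'; have [ik ekp sp] := kp; have [ii eiq sq] := iq.
have [ik' ekp' sp'] := kp'.
have [l lE] := free_projective p' sq.
pose T : lmodType R := (H * free R X)%type.
have [|h hE] := @linear_bundle R H T (fun x => (x, 0)).
  by move=> c x y /=; congr pair; rewrite /= scaler0 addr0.
have [|x xE] := @linear_bundle R T (free R X) snd; first by [].
have [|h' h'E] := @linear_bundle R T H fst; first by [].
have [|s sE] := @linear_bundle R T P (fun z => i (p z.1) + l z.2).
  by move=> c y z /=; rewrite !linearP /= scalerDr addrACA.
have hx : short_exact h x.
  split=> [y z|y|y].
  - by rewrite !hE => -[].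
  - rewrite xE; split=> [y0|[z <-]]; last by rewrite hE.
    by exists y.1; rewrite hE -y0 -surjective_pairing.
  - by exists (0, y); rewrite xE.
have ss : surjective s.
  move=> y; have [w wE] := sp' (q y).
  have /eiq[z zE] : q (y - l w) = 0 by rewrite linearB lE wE subrr.
  have [t tE] := sp z; exists (t, w).
  by rewrite sE /= tE zE subrK.
have [c [cs cI]] : exists c : {linear lker s -> T}, short_exact c s /\ injective c.
  by exists val; split; [exact: lker_short_exact|exact: val_inj].
have [_ ecs _] := cs.
have pE z : p' (x z) = q (s z).
  by rewrite sE linearD (short_exact_comp0 iq) add0r lE xE.
have [|u uE] := @linear_factor_inj R _ _ _ c (h \o k) cI.
  by move=> y; apply/ecs; rewrite /= hE sE /= (short_exact_comp0 kp) !linear0 addr0.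
have [|v vE] := @linear_factor_inj R _ _ _ k' (x \o c) ik'.
  by move=> y; apply/ekp'; rewrite /= pE (short_exact_comp0 cs) linear0.
have [ih ehx _] := hx.
exists T, (lker s), h, x, c, s, u, v; split=> //; split=> [y z|y|y].
- by move=> /(congr1 c); rewrite !uE /= => /ih/ik.
- split=> [vy|[z <-]]; last first.
    by apply: ik'; rewrite vE /= uE /= (short_exact_comp0 hx) linear0.
  have /ehx[z zE] : x (c y) = 0 by rewrite -[x _]vE vy linear0.
  have /ekp[w wE] : p z = 0.
    apply: ii; rewrite linear0 -(short_exact_comp0 cs y) -zE sE hE /=.
    by rewrite linear0 addr0.
  by exists w; apply: cI; rewrite uE /= wE.
- have /eiq[z zE] : q (- l (k' y)) = 0.
    by rewrite linearN lE (short_exact_comp0 kp') oppr0.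
  have [w wE] := sp z; have /ecs[t tE] : s (w, k' y) = 0.
    by rewrite sE /= wE zE addNr.
  by exists t; apply: ik'; rewrite vE /= tE xE.
Qed.

Lemma gf_resolved_ext n (L P G : lmodType R)
    (i : {linear L -> P}) (q : {linear P -> G}) :
  short_exact i q -> gf_resolved n L -> gorenstein_flat G -> gf_resolved n P.
Proof.
elim: n L P G i q => [|n IHn] L P G i q iq; first exact: hR iq.
move=> [L' [H [k [p [kp gH rL']]]]] gG.
have fp := short_exact_free G.
have gF := flat_gorenstein_flat (@free_flat R G).
have gG' := gorenstein_flat_kernel fp gF gG.
have [T [K [h [x [c [s [u [v [hx cs uv]]]]]]]]] := horseshoe kp iq fp.
exists K, T, c, s; split=> //; first exact: hR hx gH gF.
exact: IHn uv rL' gG'.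
Qed.

(** Given a presentation [L -> H -> P], the kernel of [H -> P -> G] is
    Gorenstein flat and presents [K] with the same [L]. *)
Lemma gf_resolved_kernel n (K P G : lmodType R)
    (i : {linear K -> P}) (q : {linear P -> G}) :
  short_exact i q -> gf_resolved n P -> gorenstein_flat G -> gf_resolved n K.
Proof.
move=> iq; have [_ _ sq] := iq.
case: n => [|n]; first exact: gorenstein_flat_kernel iq.
move=> [L [H [k [p [kp gH rL]]]]] gG; have [_ _ sp] := kp.
have sqp : surjective (q \o p).
  by move=> z; have [y <-] := sq z; have [x <-] := sp y; exists x.
have Kqp := lker_short_exact sqp.
have [u [v [uv _ _]]] := ker_chain (r := q \o p) kp iq (fun=> erefl) Kqp.
exists L, (lker (q \o p)), u, v; split=> //.
exact: gorenstein_flat_kernel Kqp gH gG.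
Qed.

(** Compare the given presentation with one, [L -> H -> M], that witnesses the
    dimension.  Their pullback is an extension of [G] by [L], and [K] is the
    kernel of its projection onto [H]. *)
Lemma gf_resolved_syzygy n (K G M : lmodType R)
    (i : {linear K -> G}) (q : {linear G -> M}) :
  short_exact i q -> gorenstein_flat G -> gf_resolved n.+1 M -> gf_resolved n K.
Proof.
move=> iq gG [L [H [k [p [kp gH rL]]]]].
have [D [a [b [c [d [ab cd _ _]]]]]] := pullback kp iq.
exact: gf_resolved_kernel cd (gf_resolved_ext ab rL gG) gH.
Qed.

Lemma trivial_short_exact (M : lmodType R) :
  exists (Z : lmodType R) (z : {linear Z -> M}),
    short_exact z (idfun : {linear M -> M}) /\ trivial_module Z.
Proof.
exists (lker (idfun : {linear M -> M})), val; split.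
  by apply: lker_short_exact => x; exists x.
by move=> z; apply: val_inj; apply/eqP; exact: (valP z).
Qed.

Lemma gf_resolvedS n (M : lmodType R) : gf_resolved n M -> gf_resolved n.+1 M.
Proof.
elim: n M => [|n IHn] M.
  move=> gM; have [Z [z [ze Z0]]] := trivial_short_exact M.
  by exists Z, M, z, idfun; split=> //; exact: trivial_gorenstein_flat.
move=> [L [G [f [g [fg gG rL]]]]]; exists L, G, f, g; split=> //.
exact: IHn.
Qed.

Lemma gf_resolved_le m n (M : lmodType R) :
  (m <= n)%N -> gf_resolved m M -> gf_resolved n M.
Proof.
move=> /subnK <-; elim: (n - m)%N => [//|k IHk] /IHk; rewrite addSn.
exact: gf_resolvedS.
Qed.

Lemma gf_resolved_Tor n (M : lmodType R) : gf_resolved n M ->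
  forall i (I : lmodType R^c), (n < i)%N -> injective_module I ->
  trivial_module (Tor i I M).
Proof.
elim: n M => [|n IHn] M rM [//|i] I ni injI.
  exact: gorenstein_flat_Tor.
have [L [G [f [g [fg gG rL]]]]] := rM; case: i ni => [//|i] ni.
apply/(Tor_shift i fg); last exact: IHn.
by move=> j; exact: gorenstein_flat_Tor.
Qed.

(** Vanishing of Tor above [n] passes from [M] to a syzygy with [n] decreased,
    until only one step is left, where [gorenstein_flat_quotient] applies. *)
Lemma gf_resolved_pred n (M : lmodType R) : gf_resolved n.+1 M ->
  (forall i (I : lmodType R^c), (n < i)%N -> injective_module I ->
     trivial_module (Tor i I M)) ->
  gf_resolved n M.
Proof.
elim: n M => [|n IHn] M [L [G [f [g [fg gG rL]]]]] TM.
  by apply: gorenstein_flat_quotient fg rL gG _ => I; exact: TM.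
exists L, G, f, g; split=> //; apply: IHn => // -[//|i] I ni injI.
apply/(Tor_shift i fg); last exact: TM.
by move=> j; exact: gorenstein_flat_Tor.
Qed.

Lemma gf_resolved_of_Tor m n (M : lmodType R) : gf_resolved m M ->
  (forall i (I : lmodType R^c), (n < i)%N -> injective_module I ->
     trivial_module (Tor i I M)) ->
  gf_resolved n M.
Proof.
move=> rM TM; have [mn|nm] := leqP m n; first exact: gf_resolved_le mn rM.
move: rM; rewrite -(subnK (ltnW nm)); elim: (m - n)%N => [//|k IHk].
rewrite addSn => rM; apply: IHk; apply: (gf_resolved_pred rM) => i I ki.
by apply: TM; exact: leq_ltn_trans (leq_addl _ _) ki.
Qed.

End GorensteinFlatDimension.

(** * Resolutions indexed by the integers *)

Section Resolutions.
Variable R : pzRingType.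

Lemma isomorphic_sym (M N : lmodType R) : isomorphic M N -> isomorphic N M.
Proof.
move=> [f [g fK gK]]; have [|h hE] := @linear_bundle R N M g.
  by move=> a x y; apply: (can_inj fK); rewrite linearP !gK.
by exists h; exists f => x; rewrite hE.
Qed.

Lemma left_resolution0 (M : lmodType R) (X : nat -> lmodType R)
    (d : forall i, {linear X i.+1 -> X i}) (e : {linear X 0%N -> M}) :
  left_resolution 0 d e -> isomorphic (X 0%N) M.
Proof.
move=> [[_ exe se] X0]; apply: (@linear_bij_isomorphic R _ _ e) => //.
apply: raddf_inj => x /exe[y <-].
by rewrite (X0 1%N isT y) linear0.
Qed.

(** Cuts a resolution at its first syzygy [L], where induction on the length
    takes place. *)
Lemma left_resolution_behead n (M : lmodType R) (X : nat -> lmodType R)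
    (d : forall i, {linear X i.+1 -> X i}) (e : {linear X 0%N -> M}) :
  left_resolution n.+1 d e ->
  exists (L : lmodType R) (k : {linear L -> X 0%N}) (e' : {linear X 1%N -> L}),
    short_exact k e /\ left_resolution n (X := fun i => X i.+1) (fun i => d i.+1) e'.
Proof.
move=> [[exd exde se] X0].
have [k [ke ik]] : exists k : {linear lker e -> X 0%N}, short_exact k e /\ injective k.
  by exists val; split; [exact: lker_short_exact|exact: val_inj].
have [_ eke _] := ke.
have [|e' e'E] := @linear_factor_inj R _ _ _ k (d 0%N) ik.
  by move=> x; apply/eke/exde; exists x.
exists (lker e), k, e'; split=> //; split; last by move=> i; exact: (X0 i.+1).
split=> [i|x|y]; first exact: exd.
  have -> : e' x = 0 <-> d 0%N x = 0.
    by rewrite -e'E; split=> [->|kx]; [rewrite linear0|apply: ik; rewrite kx linear0].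
  exact: exd.
have /exde[x xE] : e (k y) = 0 by exact: short_exact_comp0 ke y.
by exists x; apply: ik; rewrite e'E.
Qed.

(** A resolution lengthened on the side of the resolved module. *)
Definition cons_module (G : lmodType R) (X : nat -> lmodType R) (i : nat) :=
  if i is j.+1 then X j else G.

Lemma left_resolution_cons n (L G M : lmodType R) (X : nat -> lmodType R)
    (d : forall i, {linear X i.+1 -> X i}) (e : {linear X 0%N -> L})
    (k : {linear L -> G}) (p : {linear G -> M}) :
  short_exact k p -> left_resolution n d e ->
  exists d' : forall i, {linear cons_module G X i.+1 -> cons_module G X i},
    left_resolution n.+1 d' p.
Proof.
move=> [ik ekp sp] [[exd exde se] X0].
exists (fun i => if i is j.+1 return
  {linear cons_module G X i.+1 -> cons_module G X i} then d j else k \o e).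
split; last by case=> // i; exact: (X0 i).
split=> // [[|i]|x]; last 2 first.
- exact: exd.
- rewrite ekp; split=> [[y <-]|[y <-]]; last by exists (e y).
  by have [z <-] := se y; exists z.
move=> x; rewrite -(exde x) /=; split=> [kex|->]; last exact: linear0.
by apply: ik; rewrite kex linear0.
Qed.

Lemma left_resolution_self (M : lmodType R) :
  exists (X : nat -> lmodType R) (d : forall i, {linear X i.+1 -> X i})
    (e : {linear X 0%N -> M}), left_resolution 0 d e /\ X 0%N = M.
Proof.
have [Z [z [ze Z0]]] := trivial_short_exact M; have [_ ez _] := ze.
exists (cons_module M (fun=> Z)).
exists (fun i => if i is j.+1 return
  {linear cons_module M (fun=> Z) i.+1 -> cons_module M (fun=> Z) i}
  then \0 else z), idfun; split=> //.
split; last by case=> // i _; exact: Z0.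
split=> // [i|x]; last by exists x.
by case: i => [|i] x; (split=> [_|[y <-]]; [exists 0|]);
   rewrite ?(Z0 x) ?linear0 //; exact: linear0.
Qed.

Lemma Gfd_le_gf_resolved n (M : lmodType R) : Gfd_le M n <-> gf_resolved n M.
Proof.
elim: n M => [|n IHn] M; split.
- move=> [X [d [e [Xr gX]]]]; apply: gorenstein_flat_iso (gX 0%N isT).
  exact: isomorphic_sym (left_resolution0 Xr).
- move=> gM; have [X [d [e [Xr X0]]]] := left_resolution_self M.
  by exists X, d, e; split=> // -[_|//]; rewrite X0.
- move=> [X [d [e [Xr gX]]]].
  have [L [k [e' [ke Lr]]]] := left_resolution_behead Xr.
  exists L, (X 0%N), k, e; split=> //; first exact: gX.
  by apply/IHn; exists (fun i => X i.+1), (fun i => d i.+1), e'; split=> // i; exact: (gX i.+1).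
- move=> [L [G [k [p [kp gG /IHn[X [d [e [Xr gX]]]]]]]]].
  have [d' Xr'] := left_resolution_cons kp Xr.
  by exists (cons_module G X), d', p; split=> // -[|i] //; exact: (gX i).
Qed.

(** Each beheading lowers the dimension by [gf_resolved_syzygy], until the last
    term is the module itself. *)
Lemma left_resolution_last n (M : lmodType R) (X : nat -> lmodType R)
    (d : forall i, {linear X i.+1 -> X i}) (e : {linear X 0%N -> M}) :
  GF_closed R -> gf_resolved n M -> left_resolution n d e ->
  (forall i, (i < n)%N -> gorenstein_flat (X i)) -> gorenstein_flat (X n).
Proof.
move=> hR; elim: n M X d e => [|n IHn] M X d e rM Xr gX.
  exact: gorenstein_flat_iso (left_resolution0 Xr) rM.
have [L [k [e' [ke Lr]]]] := left_resolution_behead Xr.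
have rL := gf_resolved_syzygy hR ke (gX 0%N isT) rM.
by apply: (IHn _ (fun i => X i.+1) _ _ rL Lr) => i; exact: (gX i.+1).
Qed.

Lemma flat_left_resolution n (M : lmodType R) :
  exists (X : nat -> lmodType R) (d : forall i, {linear X i.+1 -> X i})
    (e : {linear X 0%N -> M}),
  left_resolution n d e /\ forall i, (i < n)%N -> flat (X i).
Proof.
elim: n M => [|n IHn] M.
  by have [X [d [e [Xr _]]]] := left_resolution_self M; exists X, d, e.
have [X [d [e [Xr fX]]]] := IHn (syzygy 1 M).
have [d' Xr'] := left_resolution_cons (short_exact_free M) Xr.
exists (cons_module (free R M) X), d', (free_eval M); split=> //.
by case=> [_|i]; [exact: free_flat|exact: (fX i)].
Qed.

End Resolutions.

(** * Finite injective dimension and the theorem *)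

Section InjectiveDimension.
Variable R : pzRingType.

Lemma injective_module_iso (S : pzRingType) (E I : lmodType S) :
  isomorphic E I -> injective_module I -> injective_module E.
Proof.
move=> [f [g' fK gK]] injI A B h k ih.
have [g gE] : exists g : {linear I -> E}, forall x, g (f x) = x.
  have [|g gE] := @linear_bundle S I E g'.
    by move=> a x y; apply: (can_inj fK); rewrite linearP !gK.
  by exists g => x; rewrite gE.
have [l lE] := injI A B h (f \o k) ih.
by exists (g \o l) => a; rewrite /= lE /= gE.
Qed.

Lemma id_leS (S : pzRingType) (E : lmodType S) n : id_le E n.+1 ->
  exists (I E' : lmodType S) (f : {linear E -> I}) (g : {linear I -> E'}),
    [/\ short_exact f g, injective_module I & id_le E' n].
Proof.
move=> [I [e [d [[ie exe exd] I0 injI]]]].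
have ses := coker_short_exact ie; have [_ ee sp] := ses.
have [|e' e'E] := @linear_factor_surj S _ _ _ (coker_pi e) (d 0%N) sp.
  by move=> x /ee xe; apply/exe.
exists (I 0%N), (coker e), e, (coker_pi e); split=> //; first exact: injI.
exists (fun i => I i.+1), e', (fun i => d i.+1); split; last 2 first.
- by move=> i; exact: (I0 i.+1).
- by move=> i; exact: (injI i.+1).
split=> [|x|i]; last exact: exd.
- apply: raddf_inj => y; have [x <-] := sp y; rewrite /= e'E => /exe xe.
  exact/ee.
- rewrite (exd 0%N); split=> [[y <-]|[y <-]]; first by exists (coker_pi e y); exact: e'E.
  by have [z <-] := sp y; exists z; rewrite e'E.
Qed.

Lemma id_le0 (S : pzRingType) (E : lmodType S) : id_le E 0 -> injective_module E.
Proof.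
move=> [I [e [d [[ie exe _] I0 injI]]]].
apply: injective_module_iso (injI 0%N isT); apply: linear_bij_isomorphic ie _.
by move=> x; apply/exe; exact: (I0 1%N).
Qed.

Lemma injective_id_le (S : pzRingType) (E : lmodType S) :
  injective_module E -> id_le E 0.
Proof.
move=> injE.
have [Z [z [ze Z0]]] := trivial_short_exact E; have [iz ez _] := ze.
exists (cons_module E (fun=> Z)), idfun.
exists (fun i => if i is j.+1 return
    {linear cons_module E (fun=> Z) i -> cons_module E (fun=> Z) i.+1}
    then \0 else \0); split; last 2 first.
- by case=> // i _; exact: Z0.
- by case.
split=> // [x|i x]; first by split=> [_|_]; [exists x|].
split=> [_|_]; last by case: i x.
by exists 0; rewrite linear0; symmetry; exact: Z0.
Qed.

(** Shifting along [E -> I -> E'] raises the degree while lowering the injective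
    dimension, and the range of degrees [i > n] is closed upwards. *)
Lemma Tor_id_le (M : lmodType R) n :
  (forall i (I : lmodType R^c), (n < i)%N -> injective_module I ->
     trivial_module (Tor i I M)) ->
  forall m i (E : lmodType R^c), (n < i)%N -> id_le E m ->
     trivial_module (Tor i E M).
Proof.
move=> TM; elim=> [|m IHm] i E ni; first by move/id_le0; exact: TM.
move=> /id_leS[I [E' [f [g [fg injI idE']]]]]; case: i ni => // i ni.
apply: (Tor_ext_l fg); first exact: TM.
by apply: IHm idE'; exact: ltnW.
Qed.

Lemma nat_leastP (P : nat -> Prop) : nat_least P <> infty <-> exists n, P n.
Proof.
rewrite /nat_least; case: pselect => [exP|nP]; split=> //.
  by move=> _; have [n /asboolP] := exP; exists n.
by move=> [n Pn]; case: nP; exists n; apply/asboolP.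
Qed.

End InjectiveDimension.

Theorem theorem2p8 (R : pzRingType) (hR : GF_closed R) (M : lmodType R)
    (n : nat) :
  [<->
    (* (1) *)
    Gfd_le M n;
    (* (2) *)
    Gfd M <> infty /\
      (forall (i : nat) (I : lmodType R^c), (n < i)%N -> injective_module I ->
         trivial_module (Tor i I M));
    (* (3) *)
    Gfd M <> infty /\
      (forall (i : nat) (E : lmodType R^c), (n < i)%N -> id_dim E <> infty ->
         trivial_module (Tor i E M));
    (* (4) *)
    forall (X : nat -> lmodType R) (d : forall i : nat, {linear X i.+1 -> X i})
        (e : {linear X 0%N -> M}),
      left_resolution n d e ->
      (forall i : nat, (i < n)%N -> gorenstein_flat (X i)) ->
      gorenstein_flat (X n) ]
  /\
  (Gfd M <> infty ->
    Gfd M = nat_sup (fun i : nat => exists E : lmodType R^c,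
              id_dim E <> infty /\ ~ trivial_module (Tor i E M))
    /\
    Gfd M = nat_sup (fun i : nat => exists I : lmodType R^c,
              injective_module I /\ ~ trivial_module (Tor i I M))).
Proof.
have TorE k : (forall i (I : lmodType R^c), (k < i)%N -> injective_module I ->
      trivial_module (Tor i I M)) <->
    (forall i (E : lmodType R^c), (k < i)%N -> id_dim E <> infty ->
      trivial_module (Tor i E M)).
  split=> TM i E ki; first by move/nat_leastP=> [m]; exact: Tor_id_le ki.
  by move=> injE; apply: TM => //; apply/nat_leastP; exists 0%N; exact: injective_id_le.
have GfdTor k : Gfd M <> infty -> Gfd_le M k <->
    (forall i (I : lmodType R^c), (k < i)%N -> injective_module I ->
      trivial_module (Tor i I M)).
  move=> /nat_leastP[m /Gfd_le_gf_resolved rM]; rewrite Gfd_le_gf_resolved.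
  by split=> [/gf_resolved_Tor|]; last exact: (gf_resolved_of_Tor hR rM).
split.
  tfae.
  - move=> Mn; have Mfin : Gfd M <> infty by apply/nat_leastP; exists n.
    by split=> //; apply/GfdTor.
  - by move=> [Mfin TM]; split=> //; apply/TorE.
  - move=> [Mfin /TorE/(GfdTor n Mfin)/Gfd_le_gf_resolved rM] X d e Xr gX.
    exact: left_resolution_last hR rM Xr gX.
  - move=> H; have [X [d [e [Xr fX]]]] := flat_left_resolution n M.
    have gX i : (i < n)%N -> gorenstein_flat (X i).
      by move=> /fX; exact: flat_gorenstein_flat.
    exists X, d, e; split=> // i; rewrite leq_eqVlt => /orP[/eqP ->|]; last exact: gX.
    exact: H Xr gX.
move=> Mfin.
have sup (P : lmodType R^c -> Prop) :
    (forall k, Gfd_le M k <-> forall i (E : lmodType R^c), (k < i)%N -> P E ->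
      trivial_module (Tor i E M)) ->
    Gfd M = nat_sup (fun i => exists E : lmodType R^c,
      P E /\ ~ trivial_module (Tor i E M)).
  move=> MP; congr nat_least; apply/funext => k; apply/propext; rewrite MP.
  split=> [TM i [E [PE nT]]|H i E ki PE].
    by rewrite leqNgt; apply/negP => ki; apply: nT; exact: TM.
  by apply: contrapT => nT; have := H i (ex_intro _ E (conj PE nT)); rewrite leqNgt ki.
split; apply: sup => k; first by rewrite GfdTor // TorE.
exact: GfdTor.
Qed.
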